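(* Fix an o-minimal structure expanding the real field $(\mathbb{R},+,\cdot)$. Let $X\subset\mathbb{R}^n$ and $Y\subset\mathbb{R}^m$ be definable sets and let $p\in\overline{X}$, $q\in\overline{Y}$. Then the germs $(X,p)$ and $(Y,q)$, equipped with the Euclidean (outer) metrics, are quasi-isometric if and only if their tangent cones $C(X,p)$ and $C(Y,q)$ (with the metrics induced by the Euclidean distances) are bi-Lipschitz homeomorphic.
   Context: ''Definable'' means definable in the fixed o-minimal structure. Tangent cone: for $X\subset\mathbb{R}^n$ and $p\in\overline{X}$, $C(X,p)=\{v\in\mathbb{R}^n:\ \exists (x_i)\subset X,\ x_i\to p,\ \exists(\lambda_i)\subset\mathbb{R}_+,\ \lambda_i\to\infty,\ v=\lim_{i\to\infty}\lambda_i(x_i-p)\}$. A horn function at $0$ is the germ at $0$ of a non-decreasing function $\varphi:\mathbb{R}_{\ge0}\to\mathbb{R}_{\ge0}$ with $\lim_{t\to0}\varphi(t)/t=0$. Local quasi-isometry: let $(X,p,d_X)$ and $(Y,q,d_Y)$ be metric germs. A map $f:(X,p)\to(Y,q)$ is a germ at $p$ of a map from a neighbourhood of $p$ in $X$ to $Y$, with $f(p)=q$ and $f(x)\to q$ as $x\to p$ (it need not be continuous away from $p$, nor injective). For subsets of Euclidean space with $p\in\overline{X}\setminus X$, the germ $(X,p)$ is understood as that of $X\cup\{p\}$ (similarly for $Y$). Let $\varphi$ be a horn function at $0$. The map $f$ is a $\varphi$-quasi-isometric embedding if there are constants $L\ge1$, $L_1,L_2>0$ and a neighbourhood $U$ of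 $p$ in $X$ such that for all $x,x'\in U$ $$\tfrac1L d_X(x,x')-\delta(x,x')\le d_Y(f(x),f(x'))\le L\,d_X(x,x')+\delta(x,x'),\qquad \delta(x,x')=L_1\varphi\big(L_2(d_X(x,p)+d_X(x',p))\big).$$ It is a $\varphi$-quasi-isometry if moreover there are a neighbourhood $V$ of $q$ in $Y$ and constants $L_1',L_2'>0$ such that for every $y\in V$ there is $x\in U$ with $d_Y(y,f(x))\le L_1'\varphi(L_2'd_X(x,p))$ (since $f$ and $\varphi$ are germs, this is understood for all sufficiently small $U$, with $V$ depending on $U$). $(X,p)$ and $(Y,q)$ are quasi-isometric if there is a $\varphi$-quasi-isometry $(X,p)\to(Y,q)$ for some horn function $\varphi$ at $0$. *)

(* Defs.v *)
From HB Require Import structures.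
From mathcomp Require Import all_boot all_order all_algebra.
From mathcomp Require Import all_classical all_reals all_analysis.
Set Implicit Arguments.
Unset Strict Implicit.
Unset Printing Implicit Defensive.
Import Order.TTheory GRing.Theory Num.Theory.
Import numFieldNormedType.Exports.
Local Open Scope classical_set_scope.
Local Open Scope ring_scope.

(* The definition of van den Dries and Coste.  By the last axiom points are
   definable, so "definable" means "definable with parameters".  The order is
   definable from the field operations: x <= y iff y = x + z * z for some z. *)
Record ominimal_structure (R : realType) := OMinimalStructure {
  definable : forall n : nat, set (set 'rV[R]_n) ;
  definable0 : forall n : nat, definable (set0 : set 'rV[R]_n) ;
  definableC : forall (n : nat) (A : set 'rV[R]_n),
    definable A -> definable (~` A) ;
  definableU : forall (n : nat) (A B : set 'rV[R]_n),
    definable A -> definable B -> definable (A `|` B) ;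
  definableX : forall (m n : nat) (A : set 'rV[R]_m) (B : set 'rV[R]_n),
    definable A -> definable B ->
    definable [set x : 'rV[R]_(m + n) | A (lsubmx x) /\ B (rsubmx x)] ;
  definable_diag : forall (n : nat) (i j : 'I_n),
    definable [set x : 'rV[R]_n | x 0 i = x 0 j] ;
  definable_proj : forall (n : nat) (A : set 'rV[R]_(n + 1)),
    definable A -> definable ((fun x : 'rV[R]_(n + 1) => lsubmx x) @` A) ;
  definable_add : definable [set x : 'rV[R]_3 | x 0 0 + x 0 1 = x 0 2] ;
  definable_mul : definable [set x : 'rV[R]_3 | x 0 0 * x 0 1 = x 0 2] ;
  (* [interval R] includes the degenerate intervals `[a, a], i.e., points,
     as well as the unbounded ones. *)
  definable1P : forall A : set 'rV[R]_1,
    definable A <->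
    exists s : seq (interval R),
      A = [set x | exists2 I : interval R, I \in s & x 0 0 \in I]
}.

(* The norm that the library puts on 'rV[R]_n is the sup norm; it induces the
   same topology as this distance. *)
Definition euclidean_dist (R : realType) (n : nat) (x y : 'rV[R]_n) : R :=
  Num.sqrt (\sum_(i < n) (x 0 i - y 0 i) ^+ 2).

Definition tangent_cone (R : realType) (n : nat) (X : set 'rV[R]_n)
    (p : 'rV[R]_n) : set 'rV[R]_n :=
  [set v | exists (x_ : nat -> 'rV[R]_n) (l_ : nat -> R),
    [/\ forall i, X (x_ i),
        x_ i @[i --> \oo] --> p,
        forall i, 0 < l_ i,
        l_ i @[i --> \oo] --> +oo
      & l_ i *: (x_ i - p) @[i --> \oo] --> v]].

(* A representative of the germ; its values at negative reals are irrelevant. *)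
Definition horn_function (R : realType) (phi : R -> R) : Prop :=
  [/\ forall t, 0 <= t -> 0 <= phi t,
      forall s t, 0 <= s -> s <= t -> phi s <= phi t
    & phi t / t @[t --> 0^'+] --> (0 : R)].

(* In this section a metric germ (X, p, dX) is given by a subset X of an
   ambient type T1, a point p of X, and a function dX on T1, of which only the
   restriction to X matters (similarly for (Y, q, dY)).  A map germ is given by
   a total function T1 -> T2, of which only the restriction to a small
   neighbourhood of p in X matters. *)
Section QuasiIsometry.
Variables (R : realType) (T1 T2 : Type).
Implicit Types (phi : R -> R) (f : T1 -> T2).

Definition nbhd_in (T : Type) (d : T -> T -> R) (X : set T) (p : T)
    (U : set T) : Prop :=
  U `<=` X /\ exists2 r : R, 0 < r & forall x, X x -> d x p < r -> U x.

Variables (dX : T1 -> T1 -> R) (X : set T1) (p : T1).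
Variables (dY : T2 -> T2 -> R) (Y : set T2) (q : T2).

Definition map_germ f : Prop :=
  [/\ exists2 U, nbhd_in dX X p U & forall x, U x -> Y (f x),
      f p = q
    & forall e : R, 0 < e -> exists2 U, nbhd_in dX X p U &
        forall x, U x -> dY (f x) q < e].

Definition quasi_isometric_embedding phi f : Prop :=
  map_germ f /\
  exists L L1 L2 : R, [/\ 1 <= L, 0 < L1, 0 < L2 &
    exists2 U, nbhd_in dX X p U & forall x x', U x -> U x' ->
      let delta := L1 * phi (L2 * (dX x p + dX x' p)) in
      L^-1 * dX x x' - delta <= dY (f x) (f x') <= L * dX x x' + delta].

Definition quasi_isometry phi f : Prop :=
  quasi_isometric_embedding phi f /\
  exists L1 L2 : R, [/\ 0 < L1, 0 < L2 &
    exists2 U0, nbhd_in dX X p U0 &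
      forall U, nbhd_in dX X p U -> U `<=` U0 ->
      exists2 V, nbhd_in dY Y q V &
        forall y, V y ->
          exists2 x, U x & dY y (f x) <= L1 * phi (L2 * dX x p)].

Definition quasi_isometric : Prop :=
  exists2 phi, horn_function phi & exists f, quasi_isometry phi f.

End QuasiIsometry.

(* The inequalities say that h and its inverse are Lipschitz, so that both are
   continuous. *)
Definition bilipschitz_homeomorphic (R : realType) (T1 T2 : Type)
    (dA : T1 -> T1 -> R) (A : set T1) (dB : T2 -> T2 -> R) (B : set T2) :
    Prop :=
  exists2 h : T1 -> T2, set_bij A B h &
    exists2 L : R, 1 <= L & forall x y, A x -> A y ->
      L^-1 * dA x y <= dB (h x) (h y) <= L * dA x y.

(* Main.v *)
Require Import Defs.
From HB Require Import structures.
From mathcomp Require Import all_boot all_order all_algebra.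
From mathcomp Require Import all_classical all_reals all_analysis.
From mathcomp Require Import ring lra.
Import Order.TTheory GRing.Theory Num.Theory.
Import numFieldNormedType.Exports.
Local Open Scope classical_set_scope.
Local Open Scope ring_scope.

(* Every set is approximated by its tangent cone up to o(|x - p|), by
   compactness of the sphere.  Conversely the cone is approximated by the set:
   for a tangent direction v, the set of scales t at which X has a point within
   e t of p + t v is definable and accumulates at 0, so by o-minimality it
   contains an interval ]0, d[.  Hence (X, p) and its cone are interchangeable up
   to errors o(|x - p|), and such errors are exactly those controlled by horn
   functions, so that the theorem reduces to cones with base point 0.  There a
   quasi-isometry f yields a bi-Lipschitz bijection as the limit of
   f (t v) / t for t -> 0 along an ultrafilter; conversely a bi-Lipschitz
   bijection h fixing 0 is a quasi-isometry, and if h does not fix 0 it is first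
   replaced by the limit of t h (v / t) for t -> 0. *)

(** * Euclidean norm *)

Definition enorm {R : realType} {n : nat} (x : 'rV[R]_n) : R :=
  euclidean_dist x 0.

Section EuclideanNorm.
Context {R : realType} {n : nat}.
Implicit Types x y z : 'rV[R]_n.

Lemma enormE x : enorm x = Num.sqrt (\sum_(i < n) x 0 i ^+ 2).
Proof.
by congr Num.sqrt; apply: eq_bigr => i _; rewrite mxE subr0.
Qed.

Lemma euclidean_distE x y : euclidean_dist x y = enorm (x - y).
Proof.
by rewrite enormE; congr Num.sqrt; apply: eq_bigr => i _; rewrite !mxE.
Qed.

Lemma enorm_ge0 x : 0 <= enorm x.
Proof. exact: sqrtr_ge0. Qed.

Lemma sum_sqr_ge0 x : 0 <= \sum_(i < n) x 0 i ^+ 2.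
Proof. by apply: sumr_ge0 => i _; exact: sqr_ge0. Qed.

Lemma sqr_enorm x : enorm x ^+ 2 = \sum_(i < n) x 0 i ^+ 2.
Proof. by rewrite enormE sqr_sqrtr // sum_sqr_ge0. Qed.

Lemma enormZ (a : R) x : enorm (a *: x) = `|a| * enorm x.
Proof.
rewrite !enormE.
under eq_bigr do rewrite mxE exprMn.
by rewrite -mulr_sumr sqrtrM ?sqr_ge0 // sqrtr_sqr.
Qed.

Lemma enorm0 : enorm (0 : 'rV[R]_n) = 0.
Proof. by rewrite -(scale0r (0 : 'rV[R]_n)) enormZ normr0 mul0r. Qed.

Lemma enormN x : enorm (- x) = enorm x.
Proof. by rewrite -scaleN1r enormZ normrN normr1 mul1r. Qed.

Lemma enormB x y : enorm (x - y) = enorm (y - x).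
Proof. by rewrite -enormN opprB. Qed.

Lemma coord_le_enorm x i : `|x 0 i| <= enorm x.
Proof.
rewrite enormE -sqrtr_sqr ler_wsqrtr // (bigD1 i) //= lerDl.
by apply: sumr_ge0 => j _; exact: sqr_ge0.
Qed.

Lemma enorm_eq0 x : enorm x = 0 -> x = 0.
Proof.
move=> x0; apply/rowP => i; rewrite mxE; apply/eqP; rewrite -normr_le0 -x0.
exact: coord_le_enorm.
Qed.

Lemma enorm_gt0 x : x != 0 -> 0 < enorm x.
Proof.
by move=> x0; rewrite lt_def enorm_ge0 andbT; apply: contra_neq x0 => /enorm_eq0.
Qed.

(** Cauchy-Schwarz, from the nonnegativity of the squared norm of [enorm y *: x - enorm x *: y],
    divided by [2 * (enorm x * enorm y)]. *)
Lemma sum_mul_le_enorm x y : \sum_(i < n) x 0 i * y 0 i <= enorm x * enorm y.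
Proof.
have [->|x0] := eqVneq x 0.
  by rewrite enorm0 mul0r big1 // => i _; rewrite mxE mul0r.
have [->|y0] := eqVneq y 0.
  by rewrite enorm0 mulr0 big1 // => i _; rewrite mxE mulr0.
have a0 := enorm_gt0 _ x0; have b0 := enorm_gt0 _ y0.
have : 0 <= \sum_(i < n) (enorm y * x 0 i - enorm x * y 0 i) ^+ 2.
  by apply: sumr_ge0 => i _; exact: sqr_ge0.
have -> : \sum_(i < n) (enorm y * x 0 i - enorm x * y 0 i) ^+ 2 =
    enorm y ^+ 2 * (\sum_(i < n) x 0 i ^+ 2)
    - 2 * (enorm x * enorm y) * (\sum_(i < n) x 0 i * y 0 i)
    + enorm x ^+ 2 * (\sum_(i < n) y 0 i ^+ 2).
  rewrite !mulr_sumr -sumrN -!big_split /=.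
  by apply: eq_bigr => i _; ring.
rewrite -!sqr_enorm.
have -> : forall s, enorm y ^+ 2 * enorm x ^+ 2 - 2 * (enorm x * enorm y) * s
    + enorm x ^+ 2 * enorm y ^+ 2 =
    2 * (enorm x * enorm y) * (enorm x * enorm y - s) by move=> s; ring.
by rewrite pmulr_rge0 ?subr_ge0 // !mulr_gt0.
Qed.

Lemma ler_enormD x y : enorm (x + y) <= enorm x + enorm y.
Proof.
rewrite -ler_sqr ?nnegrE ?enorm_ge0 ?addr_ge0 ?enorm_ge0 //.
rewrite sqrrD !sqr_enorm.
under eq_bigr do rewrite mxE sqrrD.
rewrite !big_split /= lerD2r lerD2l mulr2n.
by apply: lerD; exact: sum_mul_le_enorm.
Qed.

Lemma ler_enorm_trans y x z : enorm (x - z) <= enorm (x - y) + enorm (y - z).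
Proof. by rewrite -[x - z](subrKA y) ler_enormD. Qed.

Lemma enorm_le_sum x : enorm x <= \sum_(i < n) `|x 0 i|.
Proof.
rewrite -ler_sqr ?nnegrE ?enorm_ge0 ?sumr_ge0 // sqr_enorm.
rewrite [leRHS]expr2 mulr_suml; apply: ler_sum => i _.
rewrite -real_normK ?num_real // expr2 ler_wpM2l //.
by rewrite (bigD1 i) //= lerDl sumr_ge0.
Qed.

Lemma enorm_le_coord x (c : R) :
  (forall i, `|x 0 i| <= c) -> enorm x <= n%:R * c.
Proof.
move=> xc; apply: le_trans (enorm_le_sum x) _.
rewrite mulr_natl -[in leRHS](card_ord n) -sumr_const.
by apply: ler_sum.
Qed.

End EuclideanNorm.

(** * Limits along ultrafilters *)

(** Compactness of [[-M, M]] gives a cluster point of the image filter, and an ultrafilter converges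
    to each of its cluster points: otherwise the complement of some ball around it would belong to
    the filter. *)
Lemma ultra_lim_real {R : realType} {T : Type} (F : set_system T)
    (u : T -> R) (M : R) : UltraFilter F ->
  (\forall t \near F, `|u t| <= M) ->
  exists l : R, forall e : R, 0 < e -> \forall t \near F, `|u t - l| < e.
Proof.
move=> UF uM.
have PF := @ultra_proper T F UF.
have [] := @segment_compact R (- M) M (u @ F) _.
  by apply: filterS uM => t; rewrite /= in_itv /= ler_norml.
move=> l [_ ul]; exists l => e e0.
have [//|Fe] := in_ultra_setVsetC [set t | `|u t - l| < e] UF.
have Fu : (u @ F) (u @` ~` [set t | `|u t - l| < e]).
  by apply: (@filterS _ F _ _ _ _ Fe) => t nt; exists t.
have [] := ul _ _ Fu (nbhsx_ballx l e e0).
move=> _ [[t nt <-]]; rewrite /ball /= distrC => lt.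
by case: nt.
Qed.

Lemma ultra_lim {R : realType} {n : nat} {T : Type} (F : set_system T)
    (u : T -> 'rV[R]_n) (M : R) : UltraFilter F ->
  (\forall t \near F, enorm (u t) <= M) ->
  exists l : 'rV[R]_n,
    forall e : R, 0 < e -> \forall t \near F, enorm (u t - l) < e.
Proof.
move=> UF uM.
have PF := @ultra_proper T F UF.
have H i : exists l : R, forall e : R, 0 < e -> \forall t \near F, `|u t 0 i - l| < e.
  apply: (@ultra_lim_real _ _ _ _ M) => //.
  by apply: filterS uM => t; apply: le_trans; exact: coord_le_enorm.
have [l lP] := choice H.
exists (\row_i l i) => e e0.
(* [n.+1] instead of [n] covers dimension 0 and makes the final inequality strict. *)
have e1 : 0 < e / n.+1%:R by rewrite divr_gt0.
have /= : \forall t \near F, forall i, `|u t 0 i - l i| < e / n.+1%:R.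
  by apply: filter_forall => i; exact: lP.
apply: filterS => t ut.
apply: (@le_lt_trans _ _ (n%:R * (e / n.+1%:R))).
  by apply: enorm_le_coord => i; rewrite !mxE ltW.
by rewrite mulrA ltr_pdivrMr // mulrC ltr_pM2l // ltr_nat.
Qed.

(** * Definable sets and functions *)

Section Definability.
Context {R : realType} (S : ominimal_structure R).

Lemma definableT {n} : definable S (setT : set 'rV[R]_n).
Proof. by rewrite -setC0; apply/definableC/definable0. Qed.

Lemma definableI {n} (A B : set 'rV[R]_n) :
  definable S A -> definable S B -> definable S (A `&` B).
Proof.
move=> dA dB; rewrite -[A `&` B]setCK setCI.
by apply/definableC/definableU; exact: definableC.
Qed.

Lemma definable_forall {n} (I : finType) (A : I -> set 'rV[R]_n) :
  (forall i, definable S (A i)) -> definable S [set x | forall i, A i x].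
Proof.
move=> dA.
have -> : [set x | forall i, A i x] = \big[setI/setT]_(i : I) A i.
  rewrite -bigcap_seq; apply/seteqP; split=> x /= xA i //; apply: xA.
  exact: mem_index_enum.
by apply: big_ind => //; [exact: definableT|exact: definableI].
Qed.

Lemma definable_interval (I : interval R) :
  definable S [set x : 'rV[R]_1 | x 0 0 \in I].
Proof.
apply/definable1P; exists [:: I]; apply/seteqP; split=> x /=.
  by exists I => //; rewrite inE.
by case=> J; rewrite inE => /eqP ->.
Qed.

Lemma definable_cast {n n'} (e : n = n') (A : set 'rV[R]_n') :
  definable S A -> definable S [set x : 'rV[R]_n | A (castmx (erefl, e) x)].
Proof.
by case: _ / e A => A; under [X in _ -> definable _ X]eq_fun do rewrite castmx_id.
Qed.

(** The projection axiom drops one coordinate at a time, hence the induction on [k]. *)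
Lemma definable_exists {n k} (A : set 'rV[R]_(n + k)) :
  definable S A -> definable S [set x : 'rV[R]_n | exists y : 'rV_k, A (row_mx x y)].
Proof.
elim: k A => [|k]; last first.
  rewrite -(addn1 k) => IH A dA.
  have := IH _ (definable_proj (definable_cast (esym (addnA n k 1)) _ dA)).
  congr (definable S _); apply/seteqP; split=> x /= [].
    move=> y [z Az e]; exists (row_mx y (rsubmx z)).
    by rewrite row_mxA -e hsubmxK.
  move=> y Ay; exists (lsubmx y), (row_mx (row_mx x (lsubmx y)) (rsubmx y)).
    by move: Ay; rewrite -{1}[y]hsubmxK row_mxA.
  by rewrite row_mxKl.
move=> A dA.
have := definable_cast (esym (addn0 n)) _ dA.
congr (definable S _); apply/seteqP; split=> x /=.
  move=> Ax; exists 0; congr A: Ax.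
  apply/rowP => i; rewrite castmxE /= cast_ord_id.
  by rewrite mxE; case: splitP => [j ij|[]//]; congr (x _ _); apply: val_inj.
case=> y; congr A.
apply/rowP => i; rewrite castmxE /= cast_ord_id.
by rewrite mxE; case: splitP => [j ij|[]//]; congr (x _ _); apply: val_inj.
Qed.

(* Allowing arbitrary coordinates on the graph spares reindexing later on. *)
Definition definable_fun {n} (f : 'rV[R]_n -> R) :=
  forall k (s : 'I_n -> 'I_k) (j : 'I_k),
    definable S [set x : 'rV[R]_k | f (\row_i x 0 (s i)) = x 0 j].

(** The preimage is the projection of the set of pairs [(x, y)] with [y] in [D] and [y] the row of
    the values [f i x]. *)
Lemma definable_preimage {n k} (f : 'I_k -> 'rV[R]_n -> R) (D : set 'rV[R]_k) :
  (forall i, definable_fun (f i)) -> definable S D ->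
  definable S [set x : 'rV[R]_n | D (\row_i f i x)].
Proof.
move=> df dD.
have := @definable_exists n k
  ([set z | setT (lsubmx z) /\ D (rsubmx z)] `&`
  [set z | forall i : 'I_k,
    f i (\row_j z 0 (lshift k j)) = z 0 (rshift n i)]) _.
have fE (x : 'rV[R]_n) (y : 'rV[R]_k) : \row_j row_mx x y 0 (lshift k j) = x.
  by apply/rowP => j; rewrite mxE row_mxEl.
have -> : (fun x : 'rV[R]_n => D (\row_i f i x)) = (fun x => exists y : 'rV_k,
    ([set z | setT (lsubmx z) /\ D (rsubmx z)] `&`
     [set z | forall i : 'I_k,
       f i (\row_j z 0 (lshift k j)) = z 0 (rshift n i)]) (row_mx x y)).
  apply/seteqP; split=> x /=.
    move=> Dx; exists (\row_i f i x); rewrite row_mxKr; split=> // i.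
    by rewrite fE row_mxEr mxE.
  case=> y []; rewrite row_mxKr fE => -[_ Dy] yE.
  by congr D: Dy; apply/rowP => i; rewrite mxE yE row_mxEr.
apply; apply: definableI.
  by apply: definableX => //; exact: definableT.
by apply: definable_forall => i; exact: df.
Qed.

Lemma definable_fun_reindex {n k} (f : 'rV[R]_n -> R) (s : 'I_n -> 'I_k) :
  definable_fun f -> definable_fun (fun x : 'rV[R]_k => f (\row_i x 0 (s i))).
Proof.
move=> df l s' j; have := df l (s' \o s) j.
congr (definable S _); apply/funext => x; congr (f _ = _).
by apply/rowP => i; rewrite !mxE.
Qed.

Lemma definable_fun_coord {n} (i : 'I_n) : definable_fun (fun x : 'rV[R]_n => x 0 i).
Proof.
move=> k s j; have := definable_diag S (s i) j.
by congr (definable S _); apply/funext => x /=; rewrite mxE.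
Qed.

Lemma definable_fun_in {n} (f : 'rV[R]_n -> R) (I : interval R) :
  definable_fun f -> definable S [set x | f x \in I].
Proof.
move=> df; have := definable_preimage (fun=> f) _ (fun=> df) (definable_interval I).
by congr (definable S _); apply/funext => x /=; rewrite mxE.
Qed.

Lemma definable_fun_cst {n} (c : R) : definable_fun (fun _ : 'rV[R]_n => c).
Proof.
move=> k s j; have := definable_fun_in _ `[c, c] (definable_fun_coord j).
congr (definable S _); apply/funext => x /=; apply/propext; rewrite in_itv /=.
by split=> [/le_anti ->|->]; rewrite ?lexx.
Qed.

Lemma definable_fun_op2 {n} (op : R -> R -> R) (f g : 'rV[R]_n -> R) :
  definable S [set x : 'rV[R]_3 | op (x 0 0) (x 0 1) = x 0 2] ->
  definable_fun f -> definable_fun g -> definable_fun (fun x => op (f x) (g x)).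
Proof.
move=> dop df dg k s j.
(* The graph of the combined function is the preimage of the graph of [op] under the triple formed
   by [f], [g] and the coordinate [j]. *)
pose h (i : 'I_3) (x : 'rV[R]_k) := if i == 0 then f (\row_i x 0 (s i)) else
  if i == 1 then g (\row_i x 0 (s i)) else x 0 j.
have dh i : definable_fun (h i).
  rewrite /h; case: (i == 0); first exact: definable_fun_reindex.
  case: (i == 1); first exact: definable_fun_reindex.
  exact: definable_fun_coord.
have := definable_preimage h _ dh dop.
by congr (definable S _); apply/funext => x /=; rewrite !mxE.
Qed.

Lemma definable_fun_add {n} (f g : 'rV[R]_n -> R) :
  definable_fun f -> definable_fun g -> definable_fun (fun x => f x + g x).
Proof. exact/definable_fun_op2/definable_add. Qed.

Lemma definable_fun_mul {n} (f g : 'rV[R]_n -> R) :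
  definable_fun f -> definable_fun g -> definable_fun (fun x => f x * g x).
Proof. exact/definable_fun_op2/definable_mul. Qed.

(** Closeness is measured coordinatewise, which makes it a finite conjunction of affine inequalities
    in [(t, x)]; the quantifier over [x] is then a projection. *)
Lemma definable_scales {n} (X : set 'rV[R]_n) (p v : 'rV[R]_n) (e : R) :
  definable S X ->
  definable S [set t : 'rV[R]_1 | exists2 x, X x &
    forall i, `|(x - p - t 0 0 *: v) 0 i| < e * t 0 0].
Proof.
move=> dX.
pose c i (x : 'rV[R]_(1 + n)) :=
  x 0 (rshift 1 i) + (- p 0 i + - v 0 i * x 0 (lshift n 0)).
have dc i : definable_fun (c i).
  apply: definable_fun_add; first exact: definable_fun_coord.
  apply: definable_fun_add; first exact: definable_fun_cst.
  apply: definable_fun_mul; first exact: definable_fun_cst.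
  exact: definable_fun_coord.
have det : definable_fun (fun x : 'rV[R]_(1 + n) => e * x 0 (lshift n 0)).
  apply: definable_fun_mul; first exact: definable_fun_cst.
  exact: definable_fun_coord.
pose et (z : 'rV[R]_(1 + n)) := e * z 0 (lshift n 0).
(* [|c| < e t] is expressed by the positivity of [e t + c] and [e t - c]. *)
pose B i : set 'rV[R]_(1 + n) := [set z | et z + c i z \in `]0, +oo[] `&`
  [set z | et z + (- 1) * c i z \in `]0, +oo[].
pose D := [set z : 'rV[R]_(1 + n) | setT (lsubmx z) /\ X (rsubmx z)] `&`
  [set z | forall i, B i z].
have BP (t : 'rV[R]_1) (x : 'rV[R]_n) i :
    B i (row_mx t x) <-> `|(x - p - t 0 0 *: v) 0 i| < e * t 0 0.
  rewrite /B /et /= /c !row_mxEl !row_mxEr !in_itv /= !andbT !mxE ltr_norml.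
  split=> [[]|/andP[]]; last by split; lra.
  by move=> ? ?; apply/andP; split; lra.
have dD : definable S D.
  apply: definableI.
    by apply: definableX => //; exact: definableT.
  apply: definable_forall => i; apply: definableI; apply: definable_fun_in;
    apply: definable_fun_add => //.
  apply: definable_fun_mul => //; exact: definable_fun_cst.
have := definable_exists D dD.
congr (definable S _); apply/seteqP; split=> t [x].
  move=> [/= [_ Xx] xt]; exists x; first by rewrite row_mxKr in Xx.
  by move=> i; apply/BP; exact: xt.
move=> Xx xt; exists x; split; first by rewrite /= row_mxKr.
by move=> i; apply/BP.
Qed.

End Definability.

(** * Finite unions of intervals to the right of 0 *)

(** By convexity, an interval that meets every []0, d[] contains everything between 0 and any of its
    positive points. *)
Lemma interval_near0 {R : realType} (I : interval R) :
  (exists2 d : R, 0 < d & forall t, 0 < t < d -> t \in I) \/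
  (exists2 d : R, 0 < d & forall t, 0 < t < d -> t \notin I).
Proof.
have [H|H] := pselect (exists2 d : R, 0 < d & forall t, 0 < t < d -> t \notin I).
  by right.
have {}H d : 0 < d -> exists2 t, 0 < t < d & t \in I.
  move=> d0; apply: contra_notP H => H; exists d => // t td.
  by apply/negP => tI; apply: H; exists t.
left; have [d /andP[d0 _] dI] := H 1 ltr01.
exists d => // t /andP[t0 td]; have [s /andP[s0 st] sI] := H t t0.
by apply: (@interval_is_interval _ I s d) => //; rewrite !ltW.
Qed.

(** If no interval of the list contained some []0, d[], each would miss some []0, d[], and so would
    the finite union, for the smallest of these [d]. *)
Lemma intervals_near0 {R : realType} (s : seq (interval R)) :
  (forall d : R, 0 < d -> exists2 t, 0 < t < d & exists2 I, I \in s & t \in I) ->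
  exists2 d : R, 0 < d & forall t, 0 < t < d -> exists2 I, I \in s & t \in I.
Proof.
move=> H; have [[I Is [d d0 dI]]|nI] := pselect (exists2 I, I \in s &
    exists2 d : R, 0 < d & forall t, 0 < t < d -> t \in I).
  by exists d => // t /dI tI; exists I.
have [d d0 dI] : exists2 d : R, 0 < d &
    forall t, 0 < t < d -> forall I, I \in s -> t \notin I.
  elim: s {H} nI => [|I s IH] nI; first by exists 1.
  have [[d d0 dI]|[d d0 dI]] := interval_near0 I.
    by case: nI; exists I; rewrite ?mem_head //; exists d.
  have [|d' d'0 d'I] := IH.
    by case=> J Js HJ; apply: nI; exists J; rewrite // inE Js orbT.
  exists (Num.min d d'); first by rewrite lt_min d0.
  move=> t; rewrite lt_min => /and3P[t0 td td'] J; rewrite inE => /predU1P[->|Js].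
    by apply: dI; rewrite t0.
  by apply: d'I; rewrite ?t0.
have [t td [I Is tI]] := H d d0.
by have := dI t td I Is; rewrite tI.
Qed.

(** * Tangent cones *)

Section TangentCone.
Context {R : realType} {n : nat}.
Implicit Types (X : set 'rV[R]_n) (p v x : 'rV[R]_n).

Lemma enorm_le_mxnorm x : enorm x <= n%:R * `|x|.
Proof.
apply: enorm_le_coord => i; rewrite /Num.norm /= mx_normrE.
exact: (le_bigmax _ (fun ij => `|x ij.1 ij.2|) (0, i)).
Qed.

Lemma mxnorm_le_enorm x : `|x| <= enorm x.
Proof.
rewrite /Num.norm /= mx_normrE; apply: bigmax_le => [|[i j] _ /=].
  exact: enorm_ge0.
by rewrite (ord1 i); exact: coord_le_enorm.
Qed.

Lemma mxnorm_lt_enorm x (e : R) : `|x| < e / n.+1%:R -> enorm x < e.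
Proof.
move=> xe; have /le_lt_trans : enorm x <= n.+1%:R * `|x|.
  by apply: le_trans (enorm_le_mxnorm x) _; rewrite ler_wpM2r // ler_nat.
by apply; rewrite mulrC -ltr_pdivlMr.
Qed.

Lemma cvg_enorm {T : Type} (F : set_system T) (u : T -> 'rV[R]_n) v :
  ProperFilter F -> u x @[x --> F] --> v <->
  (forall e : R, 0 < e -> \forall t \near F, enorm (u t - v) < e).
Proof.
move=> PF; split=> [/cvgrPdistC_lt uv e e0|uv].
  have := uv (e / n.+1%:R) (divr_gt0 e0 (ltr0Sn _ _)).
  by apply: filterS => t; exact: mxnorm_lt_enorm.
apply/cvgrPdistC_lt => e e0; apply: filterS (uv e e0) => t.
by apply: le_lt_trans; exact: mxnorm_le_enorm.
Qed.

Lemma closure_enorm X p :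
  closure X p -> forall e : R, 0 < e -> exists2 x, X x & enorm (x - p) < e.
Proof.
move=> Xp e e0.
have [x [Xx xp]] := Xp _ (nbhsx_ballx p (e / n.+1%:R) (divr_gt0 e0 (ltr0Sn _ _))).
exists x => //; apply: mxnorm_lt_enorm.
by move: xp; rewrite -ball_normE /ball_ /= distrC.
Qed.

(** The tangent cone without sequences: [t] stands for the inverse of the multiplier [l_ i], and one
    [e] bounds both the scale and the relative error. *)
Definition scaled_approx X p v := forall e : R, 0 < e ->
  exists2 t, 0 < t < e & exists2 x, X x & enorm (x - p - t *: v) < e * t.

Lemma tangent_coneP X p v : tangent_cone X p v <-> scaled_approx X p v.
Proof.
split=> [[x [l [Xx xp l0 loo xv]]] e e0|H].
  have /cvg_enorm/(_ e e0) lv := xv.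
  (* The [+ 1] turns the large inequality into the strict [(l i)^-1 < e]. *)
  have /cvgryPge/(_ (e^-1 + 1)) le := loo.
  have [i [li vi]] : exists i, e^-1 + 1 <= l i /\ enorm (l i *: (x i - p) - v) < e.
    have [i ?] := filter_ex (filterI le lv).
    by exists i.
  have ei0 : 0 < e^-1 by rewrite invr_gt0.
  exists (l i)^-1.
    by rewrite invr_gt0 l0 /= invf_plt ?posrE // (lt_le_trans _ li) // ltrDl.
  exists (x i) => //.
  have -> : x i - p - (l i)^-1 *: v = (l i)^-1 *: (l i *: (x i - p) - v).
    by rewrite scalerBr scalerA mulVf ?scale1r // gt_eqF.
  rewrite enormZ gtr0_norm ?invr_gt0 // mulrC ltr_pM2r ?invr_gt0 //.
(* Conversely, the choices for [e = 1 / (i + 1)] form the sequence, with multipliers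
   [(f i).1^-1]. *)
have H' i : exists tx : R * 'rV[R]_n, [/\ 0 < tx.1 < i.+1%:R^-1, X tx.2 &
     enorm (tx.2 - p - tx.1 *: v) < i.+1%:R^-1 * tx.1].
  have [|t t1 [x Xx xt]] := H i.+1%:R^-1; first by rewrite invr_gt0.
  by exists (t, x).
have [f fP] := choice H'.
have small (c : R) (e : R) : 0 < e -> \forall i \near \oo, c * i.+1%:R^-1 < e.
  move=> e0.
  have /cvgrPdist_lt/(_ e e0) : (c * i.+1%:R^-1) @[i --> \oo] --> c * (0 : R).
    by apply: cvgMr; exact: cvg_harmonic.
  apply: filterS => i; rewrite mulr0 sub0r normrN.
  by apply: le_lt_trans; exact: ler_norm.
exists (fun i => (f i).2), (fun i => (f i).1^-1); split.
- by move=> i; case: (fP i).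
- apply/cvg_enorm => e e0; apply: filterS (small (1 + enorm v) e e0) => i.
  apply: le_lt_trans; have [/andP[t0 t1] _ vt] := fP i.
  have i1 : (i.+1%:R : R)^-1 <= 1 by rewrite invf_le1 ?ler1n.
  have := ler_enormD ((f i).2 - p - (f i).1 *: v) ((f i).1 *: v).
  rewrite subrK enormZ gtr0_norm // => h; apply: le_trans h _.
  rewrite mulrDl mul1r; apply: lerD; last by rewrite mulrC ler_wpM2l ?enorm_ge0 // ltW.
  by apply: le_trans (ltW vt) _; apply: le_trans (ltW t1); rewrite ler_piMl // ltW.
- by move=> i; rewrite invr_gt0; case: (fP i) => /andP[].
- apply/cvgryPge => A; apply: filterS (small A 1 ltr01) => i.
  have [/andP[t0 t1] _ _] := fP i.
  rewrite -ltr_pdivlMr ?invr_gt0 // invrK mul1r => /ltW/le_trans; apply.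
  by rewrite ltW // -ltf_pV2 ?invrK ?posrE ?invr_gt0.
apply/cvg_enorm => e e0; apply: filterS (small 1 e e0) => i.
have [/andP[t0 t1] _ vt] := fP i; rewrite mul1r; apply: le_lt_trans.
have -> : (f i).1^-1 *: ((f i).2 - p) - v =
    (f i).1^-1 *: ((f i).2 - p - (f i).1 *: v).
  by rewrite [RHS]scalerBr scalerA mulVf ?scale1r // gt_eqF.
by rewrite enormZ gtr0_norm ?invr_gt0 // mulrC ler_pdivrMr // ltW.
Qed.

Lemma tangent_cone0 X p : closure X p -> tangent_cone X p 0.
Proof.
move=> Xp; apply/tangent_coneP => e e0.
have e2 : 0 < e / 2 by lra.
have [|x Xx xp] := closure_enorm _ _ Xp (e * (e / 2)); first exact: mulr_gt0.
exists (e / 2); first by apply/andP; split; lra.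
by exists x => //; rewrite scaler0 subr0.
Qed.

Lemma tangent_coneZ X p v (s : R) :
  0 < s -> tangent_cone X p v -> tangent_cone X p (s *: v).
Proof.
move=> s0 /tangent_coneP Cv; apply/tangent_coneP => e e0.
have si0 : 0 < s^-1 by rewrite invr_gt0.
(* The scale for [s *: v] is [t / s]: the bound [e * s] makes it smaller than [e], and [e / s] makes
   the error at most [e * (t / s)]. *)
have [|t /andP[t0 te] [x Xx xt]] := Cv (Num.min (e * s) (e / s)).
  by rewrite lt_min !mulr_gt0.
exists (t / s).
  by rewrite divr_gt0 //= ltr_pdivrMr // (lt_le_trans te) // ge_min lexx.
exists x => //.
rewrite scalerA divfK ?gt_eqF //; apply: lt_le_trans xt _.
rewrite mulrA -(mulrAC e) ler_pM2r //.
by rewrite ge_min lexx orbT.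
Qed.

Lemma tangent_cone_closed X p v :
  (forall e : R, 0 < e -> exists2 w, tangent_cone X p w & enorm (w - v) < e) ->
  tangent_cone X p v.
Proof.
move=> Cv; apply/tangent_coneP => e e0.
have e2 : 0 < e / 2 by lra.
have [w /tangent_coneP/(_ _ e2)[t /andP[t0 te] [x Xx xt]] wv] := Cv _ e2.
exists t; first by apply/andP; split; lra.
exists x => //.
have -> : x - p - t *: v = (x - p - t *: w) + t *: (w - v).
  by rewrite scalerBr addrA subrK.
apply: le_lt_trans (ler_enormD _ _) _; rewrite enormZ gtr0_norm //.
by nra.
Qed.

(* O-minimality enters here, and only here: the scales at which [X] comes
   close to a tangent direction are all small scales. *)
Lemma tangent_cone_all_scales (S : ominimal_structure R) X p v :
  definable S X -> tangent_cone X p v -> forall e : R, 0 < e ->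
  exists2 d : R, 0 < d & forall t, 0 < t < d ->
    exists2 x, X x & enorm (x - p - t *: v) <= e * t.
Proof.
move=> dX /tangent_coneP Cv e e0.
(* The division pays for the passage from coordinates back to the Euclidean norm. *)
have e1 : 0 < e / n.+1%:R by rewrite divr_gt0.
have := definable_scales S X p v (e / n.+1%:R) dX.
move=> /definable1P[s sE].
have sP t : (exists2 x, X x &
    forall i, `|(x - p - t *: v) 0 i| < e / n.+1%:R * t) <->
    exists2 I, I \in s & t \in I.
  move/seteqP : sE => [/(_ (const_mx t)) + /(_ (const_mx t))].
  by rewrite /= mxE => ? ?.
have [|d d0 dP] := intervals_near0 s.
  move=> d d0; have [|t /andP[t0 td] [x Xx xt]] := Cv (Num.min d (e / n.+1%:R)).
    by rewrite lt_min d0.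
  exists t; first by rewrite t0 (lt_le_trans td) // ge_min lexx.
  apply/sP; exists x => // i; apply: le_lt_trans (coord_le_enorm _ i) _.
  by apply: lt_le_trans xt _; rewrite ler_pM2r // ge_min lexx orbT.
exists d => // t td; have /sP[x Xx xt] := dP t td; exists x => //.
apply: le_trans (enorm_le_coord _ (e / n.+1%:R * t) (fun i => ltW (xt i))) _.
have /andP[t0 _] := td.
by rewrite !mulrA ler_pM2r // ler_pdivrMr // mulrC ler_pM2l // ler_nat.
Qed.

End TangentCone.

(** * Mutual approximation of a set and its cone *)

(** Every bounded function of [t] has a limit along this [F], which replaces the extraction of
    subsequences as [t] tends to 0 from the right. *)
Lemma ultra_at_right {R : realType} : exists2 F : set_system R, UltraFilter F &
  forall d : R, 0 < d -> \forall t \near F, 0 < t < d.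
Proof.
have [F [UF F0]] := ultraFilterLemma (at_right_proper_filter (0 : R)).
exists F => // d d0; apply: F0.
by near=> t; apply/andP; split.
Unshelve. all: by end_near. Qed.

Section Approximation.
Context {R : realType} {n : nat}.
Implicit Types (A B X : set 'rV[R]_n) (a b p u v x y : 'rV[R]_n).

(** One-sided, since the two directions between a set and its cone have different proofs:
    o-minimality enters from the cone to the set. *)
Definition approximable A a B b := forall e : R, 0 < e ->
  exists2 d : R, 0 < d & forall x, A x -> enorm (x - a) < d ->
    exists2 y, B y & enorm ((x - a) - (y - b)) <= e * enorm (x - a).

(* Compactness of the unit sphere: a property of the points of [A] near [a]
   may be checked around each limit direction [u]. *)
Lemma limit_direction_ind A a (Q : set 'rV[R]_n) :
  (forall u, (forall e : R, 0 < e -> exists2 x, A x &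
      0 < enorm (x - a) < e /\
      enorm (x - a - enorm (x - a) *: u) < e * enorm (x - a)) ->
    exists2 d : R, 0 < d & forall x, A x -> 0 < enorm (x - a) < d ->
      enorm (x - a - enorm (x - a) *: u) < d * enorm (x - a) -> Q x) ->
  exists2 d : R, 0 < d & forall x, A x -> 0 < enorm (x - a) < d -> Q x.
Proof.
move=> H; apply: contrapT => nQ.
(* If no [d] works, every scale [d] has a counterexample [x d]; for [d <= 0] the value is a
   dummy. *)
have {}nQ (d : R) : exists x, 0 < d -> [/\ A x, 0 < enorm (x - a) < d & ~ Q x].
  have [d0|nd] := pselect (0 < d); last by exists 0.
  apply: contra_notP nQ => nx; exists d => // x Ax xd.
  by apply: contra_notP nx => nQ; exists x.
have [x xP] := choice nQ.
have [F UF F0] := @ultra_at_right R.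
have PF := @ultra_proper _ F UF.
pose s t := enorm (x t - a).
(* The unit directions of the counterexamples converge to some [u], and the hypothesis for this [u]
   contradicts [~ Q (x t)]. *)
have [|u uP] := @ultra_lim R n R F (fun t => (s t)^-1 *: (x t - a)) 1 UF.
  apply: filterS (F0 1 ltr01) => t /andP[t0 _].
  have [_ /andP[s0 _] _] := xP t t0.
  by rewrite enormZ gtr0_norm ?invr_gt0 // mulVf // gt_eqF.
have close e : 0 < e -> \forall t \near F, [/\ A (x t), 0 < s t < e, ~ Q (x t) &
    enorm (x t - a - s t *: u) < e * s t].
  move=> e0; apply: filterS2 (F0 e e0) (uP e e0) => t /andP[t0 te] ut.
  have [Axt /andP[s0 st] nQt] := xP t t0.
  split=> //; first by rewrite s0 (lt_trans st).
  have -> : x t - a - s t *: u = s t *: ((s t)^-1 *: (x t - a) - u).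
    by rewrite scalerBr scalerA divff ?scale1r // gt_eqF.
  by rewrite enormZ gtr0_norm // mulrC ltr_pM2r.
have [|d d0 dP] := H u.
  move=> e e0; have [t [Axt st _ xu]] := filter_ex (close e e0).
  by exists (x t).
have [t [Axt st nQt xu]] := filter_ex (close d d0).
by apply: nQt; exact: dP.
Qed.

Lemma approximable_pointed A a B b : B b ->
  (forall e : R, 0 < e -> exists2 d : R, 0 < d &
    forall x, A x -> 0 < enorm (x - a) < d ->
    exists2 y, B y & enorm ((x - a) - (y - b)) <= e * enorm (x - a)) ->
  approximable A a B b.
Proof.
move=> Bb H e e0; have [d d0 dP] := H e e0; exists d => // x Ax xd.
have [xa|x0] := eqVneq (enorm (x - a)) 0.
  by exists b; rewrite // subrr subr0 xa mulr0.
by apply: dP => //; rewrite xd lt_def x0 enorm_ge0.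
Qed.

(** A limit direction [u] of the set is tangent, so [enorm (x - p) *: u] is a point of the cone
    close to [x - p] for all [x] near that direction. *)
Lemma approximable_by_cone X p : closure X p ->
  approximable (X `|` [set p]) p (tangent_cone X p) 0.
Proof.
move=> Xp; apply: approximable_pointed; first exact: tangent_cone0.
move=> e e0; apply: limit_direction_ind => u uP.
exists e => // x _ /andP[s0 _] xe; exists (enorm (x - p) *: u).
  apply: tangent_coneZ => //; apply/tangent_coneP => d d0.
  have [y [Xy|->] [/andP[y0 yd] yu]] := uP d d0.
    by exists (enorm (y - p)); [rewrite y0|exists y].
  by rewrite subrr enorm0 ltxx in y0.
by rewrite subr0 ltW.
Qed.

(** A limit direction [u] of the cone lies in it by closedness, so the set has a point near
    [p + enorm v *: u] for every small [v]. Half of the error is spent there, half between [v] and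
    [enorm v *: u]. *)
Lemma approximable_cone (S : ominimal_structure R) X p : definable S X ->
  approximable (tangent_cone X p) 0 (X `|` [set p]) p.
Proof.
move=> dX; apply: approximable_pointed; first by right.
move=> e e0; apply: limit_direction_ind => u uP.
have e2 : 0 < e / 2 by lra.
have Cu : tangent_cone X p u.
  apply: tangent_cone_closed => d d0; have [v Cv [/andP[v0 vd] vu]] := uP d d0.
  rewrite !subr0 in v0 vd vu.
  exists ((enorm v)^-1 *: v); first by apply: tangent_coneZ; rewrite ?invr_gt0.
  have -> : (enorm v)^-1 *: v - u = (enorm v)^-1 *: (v - enorm v *: u).
    by rewrite scalerBr scalerA mulVf ?scale1r // gt_eqF.
  by rewrite enormZ gtr0_norm ?invr_gt0 // mulrC ltr_pdivrMr.
have [d d0 dP] := tangent_cone_all_scales S X p u dX Cu _ e2.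
exists (Num.min d (e / 2)); first by rewrite lt_min d0.
move=> v _; rewrite !subr0 lt_min => /and3P[v0 vd _] vu.
have [|x Xx xu] := dP (enorm v); first by rewrite v0.
exists x; first by left.
have -> : v - (x - p) = v - enorm v *: u - (x - p - enorm v *: u).
  by rewrite [in RHS]opprB addrA subrK.
apply: le_trans (ler_enormD _ _) _; rewrite enormN.
have {vu} : enorm (v - enorm v *: u) < e / 2 * enorm v.
  by apply: lt_le_trans vu _; rewrite ler_pM2r // ge_min lexx orbT.
lra.
Qed.

End Approximation.

(** * Horn functions *)

Section HornFunctions.
Context {R : realType}.
Implicit Types phi : R -> R.

Lemma horn_small phi : horn_function phi -> forall e : R, 0 < e ->
  exists2 d : R, 0 < d & forall t, 0 <= t < d -> phi t <= e * t.
Proof.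
move=> [phi0 phi_mono /cvgrPdist_lt phi_lim] e e0.
have [d /= d0 dP] := phi_lim e e0.
have H t : 0 < t < d -> phi t <= e * t.
  move=> /andP[t0 td]; have := dP t; rewrite /= sub0r normrN gtr0_norm // => /(_ td t0).
  rewrite sub0r normrN => h.
  by rewrite -ler_pdivrMr //; apply: le_trans (ler_norm _) (ltW h).
exists d => // t /andP[]; rewrite le_eqVlt => /predU1P[<- _|t0 td]; last first.
  by apply: H; rewrite t0.
(* At [t = 0] monotonicity gives [phi 0 <= phi s <= e * s <= r] for a small positive [s]. *)
rewrite mulr0; apply/ler_addgt0Pl => r r0; rewrite addr0.
pose s := Num.min (d / 2) (r / e).
have s0 : 0 < s by rewrite lt_min !divr_gt0.
have sd : s < d by rewrite (@le_lt_trans _ _ (d / 2)) ?ge_min ?lexx //; lra.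
apply: le_trans (phi_mono 0 s _ (ltW s0)) _ => //.
apply: le_trans (H s _) _; first by rewrite s0.
by rewrite -ler_pdivlMl // mulrC ge_min lexx orbT.
Qed.

(* [phi t / t] is the infimum of the moduli valid at scale [t], plus [t] since
   the infimum need not be attained. *)
Lemma horn_of_modulus (Q : R -> R -> Prop) :
  (forall e, 0 < e -> exists2 d : R, 0 < d & Q e d) ->
  (forall e e' d d', Q e d -> e <= e' -> d' <= d -> Q e' d') ->
  exists2 phi, horn_function phi &
    exists2 r : R, 0 < r & forall t, 0 < t < r -> Q (phi t / t) t.
Proof.
move=> HQ Qmono.
(* The default element 1 keeps [E t] nonempty when no modulus holds at scale [t]. *)
pose E t : set R := [set e | 0 < e <= 1 /\ (e = 1 \/ Q e t)].
have E1 t : E t 1 by split; [rewrite ltr01 lexx|left].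
have lbE t : has_lbound (E t) by exists 0 => e [/andP[/ltW]].
have iE t : has_inf (E t) by split=> //; exists 1.
have inf0 t : 0 <= inf (E t).
  by apply: lb_le_inf; [exists 1|move=> e [/andP[/ltW]]].
pose phi t := t * (inf (E t) + t).
have phiE t : 0 < t -> phi t / t = inf (E t) + t.
  by move=> t0; rewrite /phi mulrAC divff ?mul1r // gt_eqF.
have small e : 0 < e -> exists2 d : R, 0 < d & forall t, t < d -> inf (E t) <= e.
  move=> e0; have m0 : 0 < Num.min e 1 by rewrite lt_min e0 ltr01.
  have [d d0 Qd] := HQ _ m0; exists d => // t td.
  apply: (@le_trans _ _ (Num.min e 1)); last by rewrite ge_min lexx.
  apply: ge_inf => //; split; first by rewrite m0 ge_min lexx orbT.
  by right; apply: Qmono Qd _ (ltW td).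
exists phi.
  split.
  - by move=> t t0; rewrite /phi mulr_ge0 // addr_ge0.
  - move=> s t s0 st; rewrite /phi ler_pM ?addr_ge0 // lerD //.
    apply: lb_le_inf; first by exists 1.
    (* A modulus valid at scale [t] is valid at the smaller scale [s], so the infimum is
       non-decreasing. *)
    move=> e [e01 eQ]; apply: ge_inf => //; split=> //.
    by case: eQ => [->|eQ]; [left|right; apply: Qmono eQ _ _].
  apply/cvgrPdist_le => e e0.
  have e2 : 0 < e / 2 by lra.
  have [d d0 dP] := small _ e2.
  near=> t.
  have t0 : 0 < t by [].
  rewrite sub0r normrN phiE // ger0_norm; last by rewrite addr_ge0 // ltW.
  have : inf (E t) <= e / 2 by apply: dP; near: t; exact: nbhs_right_lt.
  have : t <= e / 2 by near: t; exact: nbhs_right_le.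
  lra.
(* With [inf (E t) <= 1 / 2] and [t < 1 / 2], an element of [E t] below their sum is not the default
   1, hence satisfies [Q]. *)
have h0 : 0 < 1 / 2 :> R by lra.
have [d d0 dP] := small _ h0.
exists (Num.min d (1 / 2)); first by rewrite lt_min d0.
move=> t; rewrite lt_min => /and3P[t0 td t2]; rewrite phiE //.
have [e [_ [e1|Qe]] et] := inf_adherent t0 (iE t).
  by have := dP t td; lra.
by apply: Qmono Qe _ _ => //; exact: ltW.
Unshelve. all: by end_near. Qed.

End HornFunctions.

(** One [g] serves every [e]: it selects points with error at most [phi (enorm (x - a))], where
    [phi] is the horn function of the approximation. *)
Lemma approximation_map {R : realType} {n} (A B : set 'rV[R]_n) (a b : 'rV[R]_n) :
  approximable A a B b ->
  exists2 g : 'rV[R]_n -> 'rV[R]_n, g a = b &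
    forall e : R, 0 < e -> exists2 d : R, 0 < d &
    forall x, A x -> x != a -> enorm (x - a) < d ->
      B (g x) /\ enorm ((x - a) - (g x - b)) <= e * enorm (x - a).
Proof.
move=> AB.
(* The large inequality allows [Q] to be used at [d = enorm (x - a)] itself; it costs the halving of
   [d] below. *)
pose Q (e d : R) := forall x, A x -> enorm (x - a) <= d ->
  exists2 y, B y & enorm ((x - a) - (y - b)) <= e * enorm (x - a).
have [||phi hphi [r r0 rP]] := horn_of_modulus Q.
- move=> e e0; have [d d0 dP] := AB e e0; exists (d / 2); first by lra.
  by move=> x Ax xd; apply: dP => //; apply: le_lt_trans xd _; lra.
- move=> e e' d d' He ee dd x Ax xd.
  have [y By yx] := He x Ax (le_trans xd dd); exists y => //.
  by apply: le_trans yx _; rewrite ler_wpM2r ?enorm_ge0.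
have H x : exists y, (x = a -> y = b) /\ (A x -> x != a -> enorm (x - a) < r ->
    B y /\ enorm ((x - a) - (y - b)) <= phi (enorm (x - a))).
  have [->|xa] := eqVneq x a; first by exists b; split.
  have s0 : 0 < enorm (x - a) by rewrite enorm_gt0 // subr_eq0.
  have [[Ax xr]|nx] := pselect (A x /\ enorm (x - a) < r).
    have [||y By yx] := rP (enorm (x - a)) _ x Ax _ => //; first by rewrite s0.
    by exists y; split=> //; [move/eqP : xa|rewrite divfK ?gt_eqF in yx].
  by exists b; split=> // Ax _ xr; case: nx.
have [g gP] := choice H.
exists g => [|e e0]; first exact: (gP a).1.
have [d d0 dP] := horn_small _ hphi e e0.
exists (Num.min d r); first by rewrite lt_min d0.
move=> x Ax xa; rewrite lt_min => /andP[xd xr].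
have [Bg gx] := (gP x).2 Ax xa xr; split=> //.
by apply: le_trans gx _; apply: dP; rewrite enorm_ge0.
Qed.

(** * Quasi-isometries without horn functions *)

Section AlmostBilipschitz.
Context {R : realType} {n m : nat}.
Implicit Types (A X : set 'rV[R]_n) (B Y : set 'rV[R]_m).
Implicit Types (a p : 'rV[R]_n) (b q : 'rV[R]_m) (f : 'rV[R]_n -> 'rV[R]_m).

(* The notion of quasi-isometry freed from horn functions: [e] stands for the
   bound on phi (t) / t at scales below [d]. *)
Definition almost_bilipschitz_at A a B b f (L K e d : R) :=
  [/\ forall x, A x -> enorm (x - a) < d -> B (f x),
      forall x x', A x -> A x' -> enorm (x - a) < d -> enorm (x' - a) < d ->
        let delta := e * (enorm (x - a) + enorm (x' - a)) in
        L^-1 * enorm (x - x') - delta <= enorm (f x - f x')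
          <= L * enorm (x - x') + delta
    & forall y, B y -> enorm (y - b) < d -> exists2 x, A x &
        enorm (x - a) <= K * enorm (y - b) /\
        enorm (y - f x) <= e * enorm (y - b)].

(** [L] and [K] are fixed before [e]; [K] keeps approximate preimages at the scale of [y], so that
    errors can be measured against [enorm (y - b)]. *)
Definition almost_bilipschitz A a B b f :=
  f a = b /\ exists L K : R, [/\ 1 <= L, 0 < K & forall e, 0 < e ->
    exists2 d : R, 0 < d & almost_bilipschitz_at A a B b f L K e d].

Lemma almost_bilipschitz_at_le A a B b f (L K e e' d d' : R) :
  almost_bilipschitz_at A a B b f L K e d -> e <= e' -> d' <= d ->
  almost_bilipschitz_at A a B b f L K e' d'.
Proof.
move=> [H1 H2 H3] ee dd; split.
- by move=> x Ax xd; apply: H1 => //; exact: lt_le_trans dd.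
- move=> x x' Ax Ax' xd xd'; have /andP[lo hi] :=
    H2 x x' Ax Ax' (lt_le_trans xd dd) (lt_le_trans xd' dd).
  have s0 : 0 <= enorm (x - a) + enorm (x' - a) by rewrite addr_ge0 ?enorm_ge0.
  have := ler_wpM2r s0 ee => le; apply/andP; split.
    by apply: le_trans lo; rewrite lerD2l lerN2.
  by apply: le_trans hi _; rewrite lerD2l.
- move=> y By yd; have [x Ax [xy yx]] := H3 y By (lt_le_trans yd dd).
  exists x => //; split=> //; apply: le_trans yx _.
  by rewrite ler_wpM2r ?enorm_ge0.
Qed.

Lemma almost_bilipschitz_norm A a B b f (L K e d : R) x : f a = b -> A a ->
  1 <= L -> 0 < d -> almost_bilipschitz_at A a B b f L K e d ->
  A x -> enorm (x - a) < d ->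
  (L^-1 - e) * enorm (x - a) <= enorm (f x - b) <= (L + e) * enorm (x - a).
Proof.
move=> fa Aa L1 d0 [_ H _] Ax xd.
have := H x a Ax Aa xd; rewrite subrr enorm0 => /(_ d0) /=.
by rewrite fa addr0 mulrBl mulrDl.
Qed.

(** [horn_of_modulus] merges the bounds for all [e] into one [phi], whose relative error at scale
    [t] is [phi t / t]. *)
Lemma almost_bilipschitz_quasi_isometric A a B b f : A a -> B b ->
  almost_bilipschitz A a B b f ->
  quasi_isometric (@euclidean_dist R n) A a (@euclidean_dist R m) B b.
Proof.
move=> Aa Bb [fa [L [K [L1 K0 H]]]].
have [phi hphi [r r0 rP]] :=
  horn_of_modulus _ H (almost_bilipschitz_at_le A a B b f L K).
have [phi0 phi_mono _] := hphi.
have [d d0 H1] := H 1 ltr01.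
exists phi => //; exists f; split; first split.
- split.
  + exists [set x | A x /\ enorm (x - a) < d].
      split=> [x []//|]; exists d => // x Ax; rewrite euclidean_distE => xd.
      by split.
    by move=> x [Ax xd]; case: H1 => + _ _; apply.
  + exact: fa.
  + move=> e e0.
    pose d' := Num.min d (e / (L + 1)).
    have d'0 : 0 < d' by rewrite lt_min d0 divr_gt0 //; lra.
    exists [set x | A x /\ enorm (x - a) < d'].
      split=> [x []//|]; exists d' => // x Ax; rewrite euclidean_distE => xd.
      by split.
    move=> x [Ax]; rewrite lt_min euclidean_distE => /andP[xd xe].
    have /andP[_] := almost_bilipschitz_norm _ _ _ _ _ _ _ _ _ x fa Aa L1 d0 H1 Ax xd.
    move=> /le_lt_trans; apply; rewrite mulrC -ltr_pdivlMr //; lra.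
- exists L, 1, 2; split=> //.
  exists [set x | A x /\ enorm (x - a) < r / 4].
    split=> [x []//|]; exists (r / 4); first by lra.
    by move=> x Ax; rewrite euclidean_distE => xd; split.
  move=> x x' [Ax xr] [Ax' xr']; rewrite /= mul1r !euclidean_distE.
  (* The factor 2 puts both points strictly below the scale [t], except when [t = 0] and both are
     [a]. *)
  set t := 2 * (_ + _).
  have [t0|t_neq0] := eqVneq t 0.
    have [x0 x'0] : enorm (x - a) = 0 /\ enorm (x' - a) = 0.
      have := enorm_ge0 (x - a); have := enorm_ge0 (x' - a); rewrite /t in t0.
      by split; lra.
    have -> : x = a by apply/eqP; rewrite -subr_eq0; apply/eqP/enorm_eq0.
    have -> : x' = a by apply/eqP; rewrite -subr_eq0; apply/eqP/enorm_eq0.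
    have p0 : 0 <= phi t by rewrite phi0 // t0.
    by rewrite !subrr !enorm0 !mulr0 sub0r add0r oppr_le0 p0.
  have xx0 := enorm_ge0 (x - a); have xx0' := enorm_ge0 (x' - a).
  have t0 : 0 < t by rewrite lt_def t_neq0 /t; lra.
  have [|_ /(_ x x' Ax Ax') + _] := rP t; first by rewrite t0 /t; lra.
  have -> : phi t / t * (enorm (x - a) + enorm (x' - a)) = phi t / 2.
    by rewrite [_ + _](_ : _ = t / 2); [rewrite mulrA divfK|rewrite /t; lra].
  have pt := phi0 t (ltW t0).
  case/(_ _ _)/andP; [rewrite /t in t0 *; lra|rewrite /t in t0 *; lra|].
  move=> lo hi; apply/andP; split; lra.
have h0 : 0 < 1 / 2 :> R by lra.
have [d2 d20 H2] := horn_small _ hphi _ h0.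
(* With [t = 2 * enorm (y - b)] and [phi t <= t / 2], the point [f x] is within [enorm (y - b) / 2]
   of [y]. Hence [enorm (y - b) <= 2 * (L + 1) * enorm (x - a)], and [t] is at most
   [4 * (L + 1) * enorm (x - a)]. *)
exists 1, (4 * (L + 1)); split; [by []|by lra|].
exists A; first by split=> //; exists 1.
move=> U [UA [u u0 uU]] _.
(* In order: [t < r]; [x] lies in [U]; [phi t <= t / 2]; the norm estimate applies to [x]. *)
pose d3 := Num.min (Num.min (r / 2) (u / K)) (Num.min (d2 / 2) (d / K)).
have d30 : 0 < d3 by rewrite !lt_min !divr_gt0.
exists [set y | B y /\ enorm (y - b) < d3].
  split=> [y []//|]; exists d3 => // y By; rewrite euclidean_distE => yd.
  by split.
move=> y [By]; rewrite !lt_min => /andP[/andP[yr yu] /andP[yd2 yd]].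
have [y0|y0] := eqVneq y b.
  have Ua : U a by apply: uU; rewrite // euclidean_distE subrr enorm0.
  exists a => //.
  by rewrite !euclidean_distE y0 fa !subrr !enorm0 mulr0 mulr_ge0 ?phi0.
have yb0 : 0 < enorm (y - b) by rewrite enorm_gt0 // subr_eq0.
pose t := 2 * enorm (y - b).
have t0 : 0 < t by rewrite /t; lra.
have tr : t < r by rewrite /t; lra.
have [|_ _ /(_ y By) []] := rP t; first by rewrite t0 tr.
  by rewrite /t; lra.
move=> x Ax [xy yx].
have Hx c : enorm (y - b) < c / K -> enorm (x - a) < c.
  by move=> yc; apply: le_lt_trans xy _; rewrite mulrC -ltr_pdivlMr.
exists x.
  by apply: uU => //; rewrite euclidean_distE; exact: Hx.
rewrite !euclidean_distE mul1r.
have pt := phi0 t (ltW t0).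
have pyx : enorm (y - f x) <= phi t / 2.
  apply: le_trans yx _; rewrite [enorm (y - b)](_ : _ = t / 2); last by rewrite /t; lra.
  by rewrite mulrA divfK // gt_eqF.
have pt2 : phi t <= 1 / 2 * t by apply: H2; rewrite ltW //= /t; lra.
have /andP[_ fx] :=
  almost_bilipschitz_norm _ _ _ _ _ _ _ _ _ x fa Aa L1 d0 H1 Ax (Hx _ yd).
have yb := ler_enorm_trans (f x) y b.
apply: (le_trans (_ : _ <= phi t / 2)) => //.
apply: (@le_trans _ _ (phi t)); first by lra.
have tE : t = 2 * enorm (y - b) by [].
clearbody t; apply: phi_mono; [exact: ltW|lra].
Qed.

End AlmostBilipschitz.

Lemma horn_rescaled_small {R : realType} (phi : R -> R) (c1 c2 : R) :
  horn_function phi -> 0 < c1 -> 0 < c2 -> forall e : R, 0 < e ->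
  exists2 d : R, 0 < d & forall t, 0 <= t < d -> c1 * phi (c2 * t) <= e * t.
Proof.
move=> hphi c10 c20 e e0.
have [|d d0 dP] := horn_small _ hphi (e / (c1 * c2)).
  by rewrite divr_gt0 // mulr_gt0.
exists (d / c2); first by rewrite divr_gt0.
move=> t /andP[t0 td]; rewrite -ler_pdivlMl //.
apply: le_trans (dP (c2 * t) _) _.
  by rewrite mulr_ge0 ?(ltW c20) //= mulrC -ltr_pdivlMr.
rewrite le_eqVlt; apply/predU1P; left.
by field; rewrite !gt_eqF.
Qed.

Section QuasiIsometricAlmostBilipschitz.
Context {R : realType} {n m : nat}.

(** The horn errors drop below any multiple of the distance to the base point. The surjectivity
    error is given in terms of [x]; the lower bound on [f] converts it into one in terms of [y]. *)
Lemma quasi_isometric_almost_bilipschitz (A : set 'rV[R]_n) (a : 'rV[R]_n)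
    (B : set 'rV[R]_m) (b : 'rV[R]_m) : A a ->
  quasi_isometric (@euclidean_dist R n) A a (@euclidean_dist R m) B b ->
  exists f, almost_bilipschitz A a B b f.
Proof.
move=> Aa [phi hphi [f [[[[U1 [U1A [r1 r10 rU1]] U1B] fa _]]]]].
move=> [L [L1 [L2 [L_ge1 L10 L20 [U2 [U2A [r2 r20 rU2]] U2P]]]]].
move=> [M1 [M2 [M10 M20 [U3 [U3A [r3 r30 rU3]] U3P]]]].
have L0 : 0 < L by lra.
exists f; split=> //; exists L, (2 * L); split=> // [|e e0]; first by lra.
have {}U1B x : A x -> enorm (x - a) < r1 -> B (f x).
  by move=> Ax xr; apply/U1B/rU1; rewrite // euclidean_distE.
have {U2P}HL c : 0 < c -> exists2 d : R, 0 < d & forall x x', A x -> A x' ->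
    enorm (x - a) < d -> enorm (x' - a) < d ->
    let delta := c * (enorm (x - a) + enorm (x' - a)) in
    L^-1 * enorm (x - x') - delta <= enorm (f x - f x')
      <= L * enorm (x - x') + delta.
  move=> c0; have [d d0 dP] := horn_rescaled_small _ _ _ hphi L10 L20 c c0.
  exists (Num.min (d / 2) r2); first by rewrite lt_min divr_gt0.
  move=> x x' Ax Ax'; rewrite !lt_min => /andP[xd xr] /andP[xd' xr'].
  have := U2P x x'; rewrite /= !euclidean_distE.
  case/(_ _ _)/andP; [by apply: rU2; rewrite // euclidean_distE..|].
  have : L1 * phi (L2 * (enorm (x - a) + enorm (x' - a))) <=
      c * (enorm (x - a) + enorm (x' - a)).
    by apply: dP; rewrite addr_ge0 ?enorm_ge0 //=; lra.
  by move=> ? ? ?; apply/andP; split; lra.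
have [d1 d10 d1P] := HL e e0.
have Li0 : 0 < L^-1 by rewrite invr_gt0.
have [|d2 d20 d2P] := HL (L^-1 / 4); first by lra.
(* The first bound leaves [L^-1 / 2 * enorm (x - a) <= enorm (y - b)]; with it, the second gives
   [c * enorm (x - a) <= e * enorm (y - b)]. *)
pose c := Num.min (L^-1 / 4) (L^-1 / 2 * e).
have c0 : 0 < c by rewrite lt_min !mulr_gt0 //; lra.
have [d3 d30 d3P] := horn_rescaled_small _ _ _ hphi M10 M20 c c0.
pose d4 := Num.min (Num.min d2 d3) r3.
have d40 : 0 < d4 by rewrite !lt_min d20 d30.
(* Surjectivity is applied to a small ball as [U], so that the preimage falls where the estimates
   hold. *)
have [|x [/= Ax]|V [_ [r5 r50 rV]] VP] := U3P [set x | A x /\ enorm (x - a) < d4].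
- split=> [x []//|]; exists d4 => // x Ax; rewrite euclidean_distE => xd.
  by split.
- by rewrite !lt_min -andbA => /and3P[_ _ xr]; apply: rU3; rewrite // euclidean_distE.
exists (Num.min (Num.min d1 r5) r1); first by rewrite !lt_min d10 r50.
split.
- by move=> x Ax; rewrite lt_min => /andP[_]; exact: U1B.
- move=> x x' Ax Ax'; rewrite !lt_min -!andbA => /and3P[xd _ _] /and3P[xd' _ _].
  exact: d1P.
move=> y By; rewrite !lt_min -andbA => /and3P[_ yr _].
have [|x [Ax]] := VP y; first by apply: rV; rewrite // euclidean_distE.
rewrite !lt_min -andbA => /and3P[xd2 xd3 _]; rewrite !euclidean_distE => yx.
exists x => //.
have {}yx : enorm (y - f x) <= c * enorm (x - a).
  by apply: le_trans yx _; apply: d3P; rewrite enorm_ge0.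
have {}lo : L^-1 * enorm (x - a) - L^-1 / 4 * enorm (x - a) <= enorm (f x - b).
  have := d2P x a Ax Aa xd2; rewrite subrr enorm0 addr0 fa => /(_ d20) /andP[].
  by [].
have yb := ler_enorm_trans y (f x) b.
rewrite (enormB (f x) y) in yb.
have x0 := enorm_ge0 (x - a).
have c1 : c <= L^-1 / 4 by rewrite ge_min lexx.
have c2 : c <= L^-1 / 2 * e by rewrite ge_min lexx orbT.
have c1x := ler_wpM2r x0 c1.
have c2x := ler_wpM2r x0 c2.
have xy : enorm (x - a) <= 2 * L * enorm (y - b).
  rewrite -mulrA mulrCA -ler_pdivrMl //.
  lra.
split=> //.
apply: le_trans yx _; apply: le_trans c2x _.
rewrite (mulrC _ e) -mulrA ler_pM2l // -mulrA ler_pdivrMl //.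
lra.
Qed.

End QuasiIsometricAlmostBilipschitz.

(** * Transfer between mutually approximable germs *)

Lemma enorm_perturb {R : realType} {n : nat} (x x' a : 'rV[R]_n)
    (y y' b : 'rV[R]_n) :
  enorm (x - x') <= enorm (y - y') + enorm (x - a - (y - b))
    + enorm (x' - a - (y' - b)).
Proof.
have -> : x - x' = (y - y') + (x - a - (y - b)) - (x' - a - (y' - b)).
  by apply/rowP => i; rewrite !mxE; ring.
apply: le_trans (ler_enormD _ _) _; rewrite enormN lerD2r.
exact: ler_enormD.
Qed.

Section Transfer.
Context {R : realType} {n m : nat}.

(** [f] is conjugated by the approximation maps [g] from [A'] to [A] and [k] from [B] to [B']; these
    move points by o(distance), so [L] survives and only the error grows. *)
Lemma almost_bilipschitz_transfer (A A' : set 'rV[R]_n) (a a' : 'rV[R]_n)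
    (B B' : set 'rV[R]_m) (b b' : 'rV[R]_m) f :
  A a -> B b -> B' b' ->
  approximable A a A' a' -> approximable A' a' A a ->
  approximable B b B' b' -> approximable B' b' B b ->
  almost_bilipschitz A a B b f ->
  exists f', almost_bilipschitz A' a' B' b' f'.
Proof.
move=> Aa Bb B'b' AA' A'A BB' B'B [fa [L [K [L1 K0 fP]]]].
have [g ga gP] := approximation_map _ _ _ _ A'A.
have [k kb kP] := approximation_map _ _ _ _ BB'.
exists (k \o f \o g); split; first by rewrite /= ga fa.
(* The passages from [y] to [B] and from [A] to [A'] each at most double the norm. *)
exists L, (4 * K); split; [by []|by lra|move=> e e0].
(* [c] dominates the multiples of [r] collected below: [5 * (L + 1) + 3] for distances and
   [16 * K * (L + 1) + 3] for surjectivity. *)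
pose c := 5 * (L + 1) + 16 * K * (L + 1) + 3.
have KL0 : 0 < K * (L + 1) by rewrite mulr_gt0 //; lra.
have c0 : 0 < c by rewrite /c -(mulrA 16); lra.
pose r := Num.min (1 / 2) (e / (2 * c)).
have r0 : 0 < r by rewrite lt_min !divr_gt0 // mulr_gt0.
have r1 : r <= 1 / 2 by rewrite ge_min lexx.
have [d1 d10 d1P] := AA' r r0.
have [d2 d20 {}gP] := gP r r0.
have [d3 d30 {}kP] := kP r r0.
have [d4 d40 d4P] := B'B r r0.
have [d5 d50 {}fP] := fP r r0.
pose d := Num.min (Num.min d1 d2) (Num.min (Num.min d3 d4) d5).
have d0 : 0 < d by rewrite !lt_min d10 d20 d30 d40 d50.
have [dd1 dd2 dd3 dd4 dd5] : [/\ d <= d1, d <= d2, d <= d3, d <= d4 & d <= d5].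
  by split; rewrite !ge_min lexx ?orbT.
have rle s : 0 <= s -> r * s <= s / 2 by move=> s0; have := ler_wpM2r s0 r1; lra.
have {}gP x : A' x -> enorm (x - a') < d ->
    [/\ A (g x), enorm (x - a' - (g x - a)) <= r * enorm (x - a') &
      enorm (g x - a) <= 2 * enorm (x - a')].
  move=> A'x xd; have s0 := enorm_ge0 (x - a').
  suff [Agx gx] : A (g x) /\ enorm (x - a' - (g x - a)) <= r * enorm (x - a').
    split=> //; have := ler_enorm_trans (x - a') (g x - a) 0; rewrite !subr0.
    rewrite (enormB (g x - a)); have := rle _ s0; lra.
  have [->|xa] := eqVneq x a'; last by apply: gP => //; exact: lt_le_trans dd2.
  by rewrite ga !subrr enorm0 mulr0.
have {}kP y : B y -> enorm (y - b) < d ->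
    B' (k y) /\ enorm (y - b - (k y - b')) <= r * enorm (y - b).
  move=> By yd.
  have [->|yb] := eqVneq y b; last by apply: kP => //; exact: lt_le_trans dd3.
  by rewrite kb !subrr enorm0 mulr0.
have fE x : A x -> enorm (x - a) < d -> enorm (f x - b) <= (L + 1) * enorm (x - a).
  move=> Ax xd.
  have /andP[_ h] := almost_bilipschitz_norm _ _ _ _ _ _ _ _ _ x fa Aa L1 d50 fP Ax
    (lt_le_trans xd dd5).
  apply: le_trans h _; rewrite ler_wpM2r ?enorm_ge0 //; lra.
have kfg x : A' x -> 2 * (L + 1) * enorm (x - a') < d ->
  [/\ A (g x), enorm (x - a' - (g x - a)) <= r * enorm (x - a'),
     enorm (g x - a) <= 2 * enorm (x - a') /\ enorm (g x - a) < d5, B' (k (f (g x))) &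
     enorm (f (g x) - b - (k (f (g x)) - b')) <= r * (2 * (L + 1) * enorm (x - a'))].
  move=> A'x xd; have s0 := enorm_ge0 (x - a').
  have Ls0 : 0 <= (L - 1) * enorm (x - a') by rewrite mulr_ge0 // subr_ge0.
  have [|Ag gx1 gx2] := gP x A'x; first by lra.
  have gd : enorm (g x - a) < d by lra.
  have fgx := fE _ Ag gd.
  have {}fgx : enorm (f (g x) - b) <= 2 * (L + 1) * enorm (x - a').
    apply: le_trans fgx _; rewrite (mulrC 2) -mulrA ler_wpM2l //; lra.
  have [|B'k kx] := kP (f (g x)) _ (le_lt_trans fgx xd).
    by case: fP => H _ _; apply: H => //; exact: lt_le_trans gd dd5.
  split=> //; first by split=> //; exact: lt_le_trans gd dd5.
  by apply: le_trans kx _; rewrite ler_pM2l.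
have rc : r * c <= e / 2.
  rewrite -ler_pdivlMr // /r; apply: (@le_trans _ _ (e / (2 * c))).
    by rewrite ge_min lexx orbT.
  by rewrite invfM mulrA.
(* Below [d / D] all intermediate points stay below [d]: [kfg] costs a factor [2 * (L + 1)] and is
   applied at distances up to [4 * K * s]. *)
pose D := 8 * (K + 1) * (L + 1).
have D0 : 0 < D by rewrite /D !mulr_gt0 //; lra.
have DE s : D * s = 8 * (K * (L + 1) * s) + 8 * ((L + 1) * s).
  by rewrite /D; ring.
exists (d / D); first by rewrite divr_gt0.
have dD s : s < d / D -> D * s < d by rewrite ltr_pdivlMr // mulrC.
have small x : A' x -> enorm (x - a') < d / D -> 2 * (L + 1) * enorm (x - a') < d.
  move=> _ /dD; rewrite DE; apply: le_lt_trans.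
  have := enorm_ge0 (x - a') => s0.
  have : 0 <= K * (L + 1) * enorm (x - a') by rewrite mulr_ge0 // ltW.
  have : 0 <= (L + 1) * enorm (x - a') by rewrite mulr_ge0 //; lra.
  by rewrite -mulrA; lra.
have KLr0 : 0 <= K * (L + 1) * r by rewrite mulr_ge0 ?(ltW KL0) ?(ltW r0).
have Lr0 : 0 <= (L + 1) * r by rewrite mulr_ge0 ?(ltW r0) //; lra.
have rL : r * (5 * (L + 1) + 3) <= e by rewrite /c in rc; lra.
have rK : r * (16 * K * (L + 1) + 3) <= e by rewrite /c in rc; lra.
split.
- by move=> x A'x xd; have [_ _ _ ? _] := kfg x A'x (small x A'x xd).
- move=> x x' A'x A'x' xd xd'.
  have [Au xu [ua ud] _ ku] := kfg x A'x (small x A'x xd).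
  have [Au' xu' [ua' ud'] _ ku'] := kfg x' A'x' (small x' A'x' xd').
  have [_ /(_ _ _ Au Au' ud ud') /= /andP[flo fhi] _] := fP.
  have W1 := enorm_perturb (g x) (g x') a x x' a'.
  have W2 := enorm_perturb x x' a' (g x) (g x') a.
  have F1 := enorm_perturb (f (g x)) (f (g x')) b (k (f (g x))) (k (f (g x'))) b'.
  have F2 := enorm_perturb (k (f (g x))) (k (f (g x'))) b' (f (g x)) (f (g x')) b.
  rewrite !(enormB (g _ - a)) in W1; rewrite !(enormB (k _ - b')) in F2.
  have s0 := enorm_ge0 (x - a'); have s0' := enorm_ge0 (x' - a').
  move: ku ku' ua ua' xu xu' W1 W2 F1 F2 flo fhi rL s0 s0' => /=.
  move: (enorm (f (g x) - b - _)) (enorm (f (g x') - b - _)) => q q'.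
  move: (enorm (x - a' - _)) (enorm (x' - a' - _)) => o o'.
  move: (enorm (k _ - k _)) (enorm (f _ - f _)) (enorm (g x - g x')) => G F W.
  move: (enorm (g x - a)) (enorm (g x' - a)) (enorm (x - x')) => v v' Z.
  move: (enorm (x - a')) (enorm (x' - a')) => s s'.
  move=> ku ku' ua ua' xu xu' W1 W2 F1 F2 flo fhi rL s0 s0'.
  have Lss := ler_wpM2r (addr_ge0 s0 s0') rL.
  have r_v : r * (v + v') <= r * (2 * s + 2 * s') by rewrite ler_pM2l //; lra.
  have LW : L * W <= L * (Z + r * s + r * s') by rewrite ler_wpM2l //; lra.
  have Li : L^-1 <= 1 by rewrite invf_le1 //; lra.
  have LZ : L^-1 * Z <= L^-1 * W + (r * s + r * s').
    have rs0 : 0 <= r * s + r * s' by rewrite addr_ge0 ?mulr_ge0 // ltW.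
    have := ler_wpM2r rs0 Li.
    have : L^-1 * Z <= L^-1 * (W + (r * s + r * s')).
      by rewrite ler_pM2l ?invr_gt0 //; lra.
    by lra.
  have Lrs : 0 <= (L - 1) * (r * (s + s')).
    by rewrite mulr_ge0 ?subr_ge0 // mulr_ge0 ?addr_ge0 // ltW.
  by apply/andP; split; lra.
move=> y B'y /dD yd.
have s0 := enorm_ge0 (y - b').
have KLs : 0 <= K * (L - 1) * enorm (y - b').
  by rewrite mulr_ge0 // mulr_ge0 ?subr_ge0 // ltW.
have Ks : 0 <= K * enorm (y - b') by rewrite mulr_ge0 // ltW.
have Ls : 0 <= (L - 1) * enorm (y - b') by rewrite mulr_ge0 ?subr_ge0.
rewrite DE in yd.
(* Backwards along the composite: [w] in [B] near [y], an approximate preimage [z] of [w] in [A],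
   then [x] in [A'] near [z]. *)
have [|w Bw yw] := d4P y B'y; first by lra.
have wb : enorm (w - b) <= 2 * enorm (y - b').
  have := ler_enorm_trans (y - b') (w - b) 0; rewrite !subr0 (enormB (w - b)).
  by have := rle _ s0; lra.
have [_ _ /(_ w Bw) []] := fP; first by lra.
move=> z Az [zw wz].
have {}zw : enorm (z - a) <= 2 * (K * enorm (y - b')).
  by apply: le_trans zw _; rewrite mulrCA ler_pM2l.
have {}wz : enorm (w - f z) <= r * (2 * enorm (y - b')).
  by apply: le_trans wz _; rewrite ler_pM2l.
have [|x A'x zx] := d1P z Az; first by lra.
have z0 := enorm_ge0 (z - a).
have xy : enorm (x - a') <= 4 * (K * enorm (y - b')).
  have := ler_enorm_trans (z - a) (x - a') 0; rewrite !subr0 (enormB (x - a')).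
  by have := rle _ z0; lra.
exists x => //; split; first by rewrite -mulrA.
have Lxy := ler_wpM2l (_ : 0 <= L + 1) xy.
have [|Au xu [ua ud] _ ku] := kfg x A'x.
  by have := Lxy ltac:(lra); lra.
have zd : enorm (z - a) < d5 by lra.
have [_ /(_ _ _ Au Az ud zd) /= /andP[_ fuz] _] := fP.
(* [g x] need not be [z], but after translation both are close to [x]. *)
have uz := enorm_perturb (g x) z a x x a'.
rewrite subrr enorm0 add0r (enormB (g x - a)) in uz.
have P1 := enorm_perturb y (k (f (g x))) b' w (f (g x)) b.
have P2 := ler_enorm_trans (f z) w (f (g x)).
rewrite (enormB (k _ - b')) in P1; rewrite (enormB (f z) (f (g x))) in P2.
move: P1 P2 uz fuz ku ua xu xy zx zw wz wb yw rK s0 KLs Ks => /=.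
move: (enorm (f (g x) - b - _)) (enorm (g x - z)) (enorm (f _ - f _)) => q W F.
move: (enorm (x - a' - _)) (enorm (g x - a)) (enorm (w - f (g x))) => o v h.
move: (enorm (y - k _)) (enorm (w - f z)) (enorm (z - a - _)) => G j i.
move: (enorm (w - b)) (enorm (y - b' - _)) (enorm (x - a')) (enorm (z - a)) => l p t z'.
move: (enorm (y - b')) => s.
move=> P1 P2 uz fuz ku ua xu xy zx zw wz wb yw rK s0 KLs Ks.
have rKs := ler_wpM2r s0 rK.
have rKL : 0 <= r * (K * (L - 1) * s) by rewrite mulr_ge0 // ltW.
have rt : r * t <= r * (4 * (K * s)) by rewrite ler_pM2l.
have rz : r * z' <= r * (2 * (K * s)) by rewrite ler_pM2l.
have rv : r * (v + z') <= r * (10 * (K * s)) by rewrite ler_pM2l //; lra.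
have LW : L * W <= L * (r * (6 * (K * s))) by rewrite ler_wpM2l //; lra.
have Lt : r * (2 * (L + 1) * t) <= r * (2 * (L + 1) * (4 * (K * s))).
  by rewrite ler_pM2l // ler_wpM2l //; lra.
lra.
Qed.

End Transfer.

(** * Rescaling limits of maps between closed cones *)

Definition metric_closed {R : realType} {n} (C : set 'rV[R]_n) := forall v,
  (forall e : R, 0 < e -> exists2 w, C w & enorm (w - v) < e) -> C v.

Definition cone {R : realType} {n} (C : set 'rV[R]_n) := forall (s : R) v,
  0 < s -> C v -> C (s *: v).

Lemma closed_ultra_lim {R : realType} {n} {T : Type} (F : set_system T)
    (C : set 'rV[R]_n) (u : T -> 'rV[R]_n) (M : R) :
  UltraFilter F -> metric_closed C ->
  (\forall t \near F, C (u t) /\ enorm (u t) <= M) ->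
  exists2 l, C l & forall e : R, 0 < e -> \forall t \near F, enorm (u t - l) < e.
Proof.
move=> UF Ccl uC; have PF := @ultra_proper _ F UF.
have [|l lP] := @ultra_lim _ _ _ F u M UF.
  by apply: filterS uC => t [].
exists l => //; apply: Ccl => e e0.
by have [t [[ut _] tl]] := filter_ex (filterI uC (lP e e0)); exists (u t).
Qed.

Section UltraLimit.
Context {R : realType} {n m : nat}.
Implicit Types (C : set 'rV[R]_n) (D : set 'rV[R]_m).

Definition pointed_bilipschitz C D (h : 'rV[R]_n -> 'rV[R]_m) (L : R) :=
  [/\ h 0 = 0, set_bij C D h & forall x y, C x -> C y ->
      L^-1 * enorm (x - y) <= enorm (h x - h y) <= L * enorm (x - y)].

(** Common core of blow-up and blow-down: the pointwise limit [h] of [g t] is bi-Lipschitz because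
    the errors vanish, and onto because approximate preimages stay bounded and so converge in the
    closed set [C]. *)
Lemma pointed_bilipschitz_ultralimit C D (F : set_system R)
    (g : R -> 'rV[R]_n -> 'rV[R]_m) (L : R) :
  UltraFilter F -> metric_closed C -> metric_closed D -> C 0 -> 1 <= L ->
  (forall v, C v -> \forall t \near F, D (g t v)) ->
  (forall M e : R, 0 < M -> 0 < e -> \forall t \near F, forall v v', C v -> C v' ->
    enorm v <= M -> enorm v' <= M ->
    L^-1 * enorm (v - v') - e <= enorm (g t v - g t v')
      <= L * enorm (v - v') + e) ->
  (forall e : R, 0 < e -> \forall t \near F, enorm (g t 0) <= e) ->
  (forall w, D w -> exists K : R, forall e : R, 0 < e -> \forall t \near F,
    exists2 u, C u & enorm u <= K /\ enorm (w - g t u) <= e) ->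
  exists h, pointed_bilipschitz C D h L.
Proof.
move=> UF Ccl Dcl C0 L1 gD gL g0 gK; have PF := @ultra_proper _ F UF.
have hex v : exists l, C v -> D l /\
    forall e : R, 0 < e -> \forall t \near F, enorm (g t v - l) < e.
  have [Cv|] := pselect (C v); last by exists 0.
  (* The 2 adds the norm of [g t 0] and the Lipschitz error, each at most 1. *)
  have [|l Dl lP] := @closed_ultra_lim _ _ _ F D (g ^~ v) (L * enorm v + 2) UF Dcl.
    have M0 : 0 < enorm v + 1 by rewrite ltr_wpDl ?enorm_ge0.
    apply: filterS3 (gD v Cv) (g0 1 ltr01) (gL _ 1 M0 ltr01) => t Dt gt0 gt.
    split=> //; have /andP[_] := gt v 0 Cv C0 ltac:(lra) ltac:(rewrite enorm0; lra).
    rewrite subr0; have := ler_enormD (g t v - g t 0) (g t 0); rewrite subrK.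
    lra.
  by exists l.
have [h hP] := choice hex.
have hL v v' : C v -> C v' ->
    L^-1 * enorm (v - v') <= enorm (h v - h v') <= L * enorm (v - v').
  move=> Cv Cv'; have [_ hv] := hP v Cv; have [_ hv'] := hP v' Cv'.
  suff H e : 0 < e -> L^-1 * enorm (v - v') <= enorm (h v - h v') + e /\
      enorm (h v - h v') <= L * enorm (v - v') + e.
    by apply/andP; split; apply/ler_addgt0Pr => e /H[].
  move=> e0; have e3 : 0 < e / 3 by lra.
  have M0 : 0 < enorm v + enorm v' + 1.
    by have := enorm_ge0 v; have := enorm_ge0 v'; lra.
  have [t [[tv tv'] gt]] :=
    filter_ex (filterI (filterI (hv _ e3) (hv' _ e3)) (gL _ _ M0 e3)).
  have vg := enorm_ge0 v; have vg' := enorm_ge0 v'.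
  have /andP[lo hi] := gt v v' Cv Cv' ltac:(lra) ltac:(lra).
  have H1 := enorm_perturb (g t v) (g t v') 0 (h v) (h v') 0.
  have H2 := enorm_perturb (h v) (h v') 0 (g t v) (g t v') 0.
  rewrite !subr0 in H1 H2.
  by rewrite (enormB (h v) (g t v)) (enormB (h v') (g t v')) in H2; lra.
exists h; split=> //.
- apply/enorm_eq0/le_anti; rewrite enorm_ge0 andbT; apply/ler_addgt0Pr => e e0.
  have e2 : 0 < e / 2 by lra.
  have [_ /(_ _ e2) h0] := hP 0 C0.
  have [t [th tg]] := filter_ex (filterI h0 (g0 _ e2)).
  have := ler_enorm_trans (g t 0) (h 0) 0; rewrite !subr0 (enormB (h 0)).
  by lra.
split.
- by move=> v Cv; have [] := hP v Cv.
- move=> v v' /set_mem Cv /set_mem Cv' hvv.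
  have /andP[+ _] := hL v v' Cv Cv'; rewrite hvv subrr enorm0.
  rewrite pmulr_rle0 ?invr_gt0; last lra.
  move=> vv; apply/eqP; rewrite -subr_eq0; apply/eqP/enorm_eq0/le_anti.
  by rewrite vv enorm_ge0.
move=> w Dw; have [K wK] := gK w Dw.
have near_w e : 0 < e -> exists2 u, C u & enorm u <= K + 1 /\ enorm (w - h u) <= e.
  move=> e0; have e4 : 0 < e / 4 by lra.
  have wKe := wK _ e4.
  have : exists u : R -> 'rV[R]_n, \forall t \near F,
      [/\ C (u t), enorm (u t) <= K & enorm (w - g t (u t)) <= e / 4].
    have H t : exists u, (exists2 u, C u & enorm u <= K /\ enorm (w - g t u) <= e / 4) ->
        [/\ C u, enorm u <= K & enorm (w - g t u) <= e / 4].
      have [[u Cu [uK uw]]|nu] := pselect (exists2 u, C u &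
          enorm u <= K /\ enorm (w - g t u) <= e / 4); first by exists u.
      by exists 0.
    have [u uP] := choice H; exists u.
    by apply: filterS wKe => t; exact: uP.
  move=> [u uP].
  have [|l Cl lP] := @closed_ultra_lim _ _ _ F C u K UF Ccl.
    by apply: filterS uP => t [].
  (* The 1 keeps [enorm l <= K + 1]; the other bound gives [L * enorm (u t - l) <= e / 4], one of
     the four errors between [w] and [h l]. *)
  have r0 : 0 < Num.min 1 (e / 4 / L) by rewrite lt_min ltr01 divr_gt0 //; lra.
  have [_ /(_ _ e4) hl] := hP l Cl.
  have M0 : 0 < `|K| + 1 by rewrite ltr_wpDl.
  have [t [[[Ct tK tw] tl] [hlt gt]]] := filter_ex (filterI (filterI uP (lP _ r0))
    (filterI hl (gL _ _ M0 e4))).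
  have KK := ler_norm K.
  have {tl} [tl1 tl2] : enorm (u t - l) < 1 /\ enorm (u t - l) < e / 4 / L.
    by move: tl; rewrite lt_min => /andP.
  have lK : enorm l <= K + 1.
    by have := ler_enorm_trans (u t) l 0; rewrite !subr0 (enormB l); lra.
  exists l => //; split=> //.
  have /andP[_] := gt (u t) l Ct Cl ltac:(lra) ltac:(lra).
  have : L * enorm (u t - l) <= e / 4.
    by rewrite mulrC -ler_pdivlMr; [exact: ltW|lra].
  have := ler_enorm_trans (g t (u t)) w (h l).
  have := ler_enorm_trans (g t l) (g t (u t)) (h l).
  by lra.
have H e : exists u, 0 < e -> [/\ C u, enorm u <= K + 1 & enorm (w - h u) <= e].
  have [/near_w[u Cu [uK uw]]|ne] := pselect (0 < e); last by exists 0.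
  by exists u.
have [u uP] := choice H.
(* The points [u e] depend on the accuracy [e]; a second limit, as [e] tends to 0, gives an exact
   preimage of [w]. *)
have [G UG G0] := @ultra_at_right R.
have PG := @ultra_proper _ G UG.
have [|l Cl lP] := @closed_ultra_lim _ _ _ G C u (K + 1) UG Ccl.
  by apply: filterS (G0 1 ltr01) => t /andP[/uP[]].
exists l => //; apply/eqP; rewrite -subr_eq0; apply/eqP/enorm_eq0/le_anti.
rewrite enorm_ge0 andbT; apply/ler_addgt0Pr => e e0.
have e2 : 0 < e / 2 by lra.
have eL : 0 < e / 2 / L by rewrite divr_gt0 //; lra.
have [t [/andP[t0 te] tl]] := filter_ex (filterI (G0 _ e2) (lP _ eL)).
have [Ct _ tw] := uP t t0.
have /andP[_ hl] := hL _ _ Cl Ct.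
have : L * enorm (l - u t) <= e / 2.
  by rewrite enormB mulrC -ler_pdivlMr; [exact: ltW|lra].
have := ler_enorm_trans (h (u t)) (h l) w; rewrite (enormB (h (u t)) w).
lra.
Qed.

(** On a bounded set, the error of [f] at the points [t *: v] is o(t), so it vanishes after division
    by [t]. *)
Lemma almost_bilipschitz_blow_up C D f :
  metric_closed C -> metric_closed D -> cone C -> cone D -> C 0 ->
  almost_bilipschitz C 0 D 0 f ->
  exists h, exists2 L : R, 1 <= L & pointed_bilipschitz C D h L.
Proof.
move=> Ccl Dcl Cc Dc C0 [f0 [L [K [L1 K0 fP]]]].
have [F UF F0] := @ultra_at_right R; have PF := @ultra_proper _ F UF.
suff [h hP] : exists h, pointed_bilipschitz C D h L by exists h, L.
have scale (M d : R) : 0 < M -> 0 < d -> \forall t \near F, 0 < t /\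
    forall k (v : 'rV[R]_k), enorm v <= M -> enorm (t *: v) < d.
  move=> M0 d0; apply: filterS (F0 (d / M) (divr_gt0 d0 M0)) => t /andP[t0 td].
  split=> // k v vM; rewrite enormZ gtr0_norm //.
  by apply: le_lt_trans (_ : t * M < d); rewrite ?ler_pM2l // -ltr_pdivlMr.
apply: (pointed_bilipschitz_ultralimit _ _ F (fun t v => t^-1 *: f (t *: v))) => //.
- move=> v Cv; have [d d0 [H _ _]] := fP 1 ltr01.
  have M0 : 0 < enorm v + 1 by rewrite ltr_wpDl ?enorm_ge0.
  apply: filterS (scale _ _ M0 d0) => t [t0 tP].
  apply: Dc; first by rewrite invr_gt0.
  by apply: H; [exact: Cc|rewrite subr0; apply: tP; lra].
(* [2 * M] bounds [enorm v + enorm v']. *)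
- move=> M e M0 e0; have [|d d0 [_ H _]] := fP (e / (2 * M)).
    by rewrite divr_gt0 // mulr_gt0.
  apply: filterS (scale _ _ M0 d0) => t [t0 tP] v v' Cv Cv' vM vM'.
  have := H (t *: v) (t *: v') (Cc _ _ t0 Cv) (Cc _ _ t0 Cv').
  rewrite /= !subr0 => /(_ (tP _ _ vM) (tP _ _ vM')).
  rewrite -!scalerBr !enormZ !gtr0_norm ?invr_gt0 //.
  have -> : e / (2 * M) * (t * enorm v + t * enorm v') =
      t * (e / (2 * M) * (enorm v + enorm v')) by ring.
  have : e / (2 * M) * (enorm v + enorm v') <= e.
    by rewrite mulrAC ler_pdivrMr ?mulr_gt0 // ler_pM2l //; lra.
  move=> le /andP[lo hi]; apply/andP; split.
    rewrite ler_pdivlMl //; apply: le_trans lo.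
    by rewrite [leLHS]mulrBr [in leLHS]mulrCA lerD2l lerN2 ler_pM2l.
  rewrite ler_pdivrMl //; apply: le_trans hi _.
  by rewrite [leRHS]mulrDr [in leRHS]mulrCA lerD2l ler_pM2l.
- move=> e e0; apply: filterE => t.
  by rewrite scaler0 f0 scaler0 enorm0 ltW.
move=> w Dw; exists (K * enorm w) => e e0.
have M0 : 0 < enorm w + 1 by rewrite ltr_wpDl ?enorm_ge0.
have [|d d0 [_ _ H]] := fP (e / (enorm w + 1)); first exact: divr_gt0.
apply: filterS (scale _ _ M0 d0) => t [t0 tP].
have [||x Cx] := H (t *: w); first exact: Dc.
  by rewrite subr0; apply: tP; lra.
rewrite !subr0 enormZ gtr0_norm // => -[xw wx].
have ti0 : 0 < t^-1 by rewrite invr_gt0.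
exists (t^-1 *: x); first exact: Cc.
rewrite enormZ gtr0_norm //; split.
  by rewrite ler_pdivrMl // mulrCA.
rewrite scalerA divff ?scale1r ?gt_eqF //.
have -> : w - t^-1 *: f x = t^-1 *: (t *: w - f x).
  by rewrite scalerBr scalerA mulVf ?scale1r // gt_eqF.
rewrite enormZ gtr0_norm // ler_pdivrMl //; apply: le_trans wx _.
rewrite mulrCA ler_pM2l // mulrAC ler_pdivrMr // ler_pM2l //; lra.
Qed.

(* A bi-Lipschitz homeomorphism of cones need not fix the origin; its blow-down
   does. *)
Lemma bilipschitz_blow_down C D :
  metric_closed C -> metric_closed D -> cone C -> cone D -> C 0 ->
  bilipschitz_homeomorphic (@euclidean_dist R n) C (@euclidean_dist R m) D ->
  exists h, exists2 L : R, 1 <= L & pointed_bilipschitz C D h L.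
Proof.
move=> Ccl Dcl Cc Dc C0 [f [fD finj fsurj] [L L1 fL]].
have [F UF F0] := @ultra_at_right R; have PF := @ultra_proper _ F UF.
suff [h hP] : exists h, pointed_bilipschitz C D h L by exists h, L.
have {}fL x y : C x -> C y ->
    L^-1 * enorm (x - y) <= enorm (f x - f y) <= L * enorm (x - y).
  by move=> Cx Cy; have := fL x y Cx Cy; rewrite !euclidean_distE.
apply: (pointed_bilipschitz_ultralimit _ _ F (fun t v => t *: f (t^-1 *: v))) => //.
- move=> v Cv; apply: filterS (F0 1 ltr01) => t /andP[t0 _].
  by apply: (Dc t) => //; apply/fD/Cc; rewrite ?invr_gt0.
- move=> M e M0 e0; apply: filterS (F0 1 ltr01) => t /andP[t0 _] v v' Cv Cv' _ _.
  have ti0 : 0 < t^-1 by rewrite invr_gt0.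
  have /andP[lo hi] := fL _ _ (Cc _ _ ti0 Cv) (Cc _ _ ti0 Cv').
  move: lo hi; rewrite -!scalerBr !enormZ !gtr0_norm // => lo hi.
  apply/andP; split.
    apply: (@le_trans _ _ (L^-1 * enorm (v - v'))); first by lra.
    by rewrite -ler_pdivrMl // mulrCA.
  apply: (@le_trans _ _ (L * enorm (v - v'))); last by lra.
  by rewrite -ler_pdivlMl // mulrCA.
- move=> e e0.
  have M0 : 0 < enorm (f 0) + 1 by rewrite ltr_wpDl ?enorm_ge0.
  apply: filterS (F0 _ (divr_gt0 e0 M0)) => t /andP[t0 te].
  rewrite scaler0 enormZ gtr0_norm //; rewrite ltr_pdivlMr // in te.
  by lra.
(* The preimage [u] of [t^-1 *: w] has norm at most [L * (t^-1 * enorm w + enorm (f 0))];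
   multiplication by [t < 1] gives this bound. *)
move=> w Dw; exists (L * (enorm w + enorm (f 0))) => e e0.
apply: filterS (F0 1 ltr01) => t /andP[t0 t1].
have ti0 : 0 < t^-1 by rewrite invr_gt0.
have [u Cu uw] := fsurj _ (Dc _ _ ti0 Dw).
exists (t *: u); first exact: Cc.
rewrite scalerA mulVf ?gt_eqF // scale1r uw scalerA divff ?gt_eqF // scale1r.
rewrite subrr enorm0; split; last exact: ltW.
have /andP[+ _] := fL u 0 Cu C0; rewrite subr0 ler_pdivrMl; last by lra.
rewrite uw enormZ gtr0_norm // => uL.
rewrite -ler_pdivlMl //; apply: le_trans uL _.
rewrite mulrCA ler_wpM2l //; first by lra.
apply: le_trans (ler_enormD _ _) _; rewrite enormN enormZ gtr0_norm //.
rewrite mulrDr lerD2l ler_peMl ?enorm_ge0 //.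
by rewrite invf_ge1 // ltW.
Qed.

Lemma pointed_bilipschitz_almost C D h (L : R) : 1 <= L -> C 0 ->
  pointed_bilipschitz C D h L -> almost_bilipschitz C 0 D 0 h.
Proof.
move=> L1 C0 [h0 [hD _ hsurj] hL]; split=> //; exists L, L; split=> //; first by lra.
move=> e e0; exists 1 => //; split.
- by move=> x Cx _; exact: hD.
- move=> x x' Cx Cx' _ _ /=; have /andP[lo hi] := hL x x' Cx Cx'.
  have : 0 <= e * (enorm (x - 0) + enorm (x' - 0)).
    by rewrite mulr_ge0 ?addr_ge0 ?enorm_ge0 // ltW.
  by move=> ?; apply/andP; split; lra.
move=> y Dy _; have [x Cx xy] := hsurj y Dy; exists x => //.
rewrite xy subrr enorm0 mulr_ge0 ?enorm_ge0 //; last exact: ltW.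
split=> //; have /andP[+ _] := hL x 0 Cx C0.
by rewrite h0 xy ler_pdivrMl //; lra.
Qed.

End UltraLimit.

(** * Germs and their tangent cones *)

Theorem theorem6p1 (R : realType) (S : ominimal_structure R) (n m : nat)
    (X : set 'rV[R]_n) (Y : set 'rV[R]_m) (p : 'rV[R]_n) (q : 'rV[R]_m)
    (defX : definable S X) (defY : definable S Y)
    (Xp : closure X p) (Yq : closure Y q) :
  quasi_isometric (@euclidean_dist R n) (X `|` [set p]) p
                  (@euclidean_dist R m) (Y `|` [set q]) q <->
  bilipschitz_homeomorphic (@euclidean_dist R n) (tangent_cone X p)
                           (@euclidean_dist R m) (tangent_cone Y q).
Proof.
have Xcl : metric_closed (tangent_cone X p) by move=> v; exact: tangent_cone_closed.
have Ycl : metric_closed (tangent_cone Y q) by move=> v; exact: tangent_cone_closed.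
have Xcone : cone (tangent_cone X p) by move=> s v; exact: tangent_coneZ.
have Ycone : cone (tangent_cone Y q) by move=> s v; exact: tangent_coneZ.
have X0 := tangent_cone0 _ _ Xp; have Y0 := tangent_cone0 _ _ Yq.
have XC := approximable_by_cone _ _ Xp; have YC := approximable_by_cone _ _ Yq.
have CX := approximable_cone S X p defX; have CY := approximable_cone S Y q defY.
have Xpp : (X `|` [set p]) p by right.
have Yqq : (Y `|` [set q]) q by right.
split=> [/(quasi_isometric_almost_bilipschitz _ _ _ _ Xpp)[f]|].
  move=> /(almost_bilipschitz_transfer _ _ _ _ _ _ _ _ _ Xpp Yqq Y0 XC CX YC CY)[f'].
  move=> /(almost_bilipschitz_blow_up _ _ _ Xcl Ycl Xcone Ycone X0)[h [L L1 [_ hbij hL]]].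
  exists h => //; exists L => // x y Cx Cy.
  by rewrite !euclidean_distE; exact: hL.
move=> /(bilipschitz_blow_down _ _ Xcl Ycl Xcone Ycone X0)[h [L L1 hP]].
have /(almost_bilipschitz_transfer _ _ _ _ _ _ _ _ _ X0 Y0 Yqq CX XC CY YC)[f] :=
  pointed_bilipschitz_almost _ _ _ _ L1 X0 hP.
exact: almost_bilipschitz_quasi_isometric.
Qed.
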